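(* Let $R$ be a Noetherian ring and $s$ a positive integer. (a) If $s \le \dim R$, there exists a sequence $a_1,\ldots,a_s \in R$ that is independent with respect to every monomial preorder. (b) If $s > \dim R$, every sequence $a_1,\ldots,a_s \in R$ is dependent with respect to every monomial preorder.
   Context: All rings are commutative with identity; $\dim$ denotes Krull dimension. A strict weak order on a set $M$ is a binary relation $\prec$ such that for all $f,g,h \in M$ with $f \prec g$: (i) $f \prec h$ or $h \prec g$, and (ii) $g \not\prec f$. A monomial preorder is a strict weak order $\prec$ on the set of monomials in the variables $x_1,x_2,\ldots$ such that (iii) $1 \prec f$ for all monomials $f \neq 1$, and (iv) for all monomials $f,g,h$: $f \prec g$ if and only if $fh \prec gh$. For a polynomial $f$ over $R$, $\operatorname{in}_\prec(f)$ is the sum of all terms of $f$ whose monomials are minimal with respect to $\prec$ among the monomials appearing in $f$ (with $\operatorname{in}_\prec(0)=0$). A sequence $a_1,\ldots,a_s \in R$ is dependent with respect to $\prec$ if there exists $f \in R[x_1,\ldots,x_s]$ with $f(a_1,\ldots,a_s)=0$ such that $\operatorname{in}_\prec(f)$ has at least one coefficient invertible in $R$; otherwise it is independent with respect to $\prec$. (Coefficients are taken with respect to all monomials, so $0$ counts as a coefficient; this matters only for the zero ring.) *)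

(* Defs.v *)
From HB Require Import structures.
From mathcomp Require Import all_boot all_order all_algebra.
(* monalg has to be imported before the classical and ereal files: in the
   other order the precedence levels of their notations clash. *)
From mathcomp Require Import finmap monalg.
From mathcomp Require Import boolp classical_sets constructive_ereal.

Set Implicit Arguments.
Unset Strict Implicit.
Unset Printing Implicit Defensive.

Import Order.TTheory GRing.Theory Num.Theory.

Local Open Scope classical_set_scope.
Local Open Scope ring_scope.

(* Rings are [comPzRingType]s, so that the zero ring is included. *)
Section Ideals.
Variable R : comPzRingType.
Implicit Types I P : set R.

Definition ideal I : Prop :=
  [/\ I 0,
      forall x y, I x -> I y -> I (x + y) &
      forall r x, I x -> I (r * x)].

Definition prime_ideal P : Prop :=
  [/\ ideal P, ~ P 1 & forall x y, P (x * y) -> P x \/ P y].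

Definition ideal_span (g : seq R) : set R :=
  [set x | exists c : nat -> R, x = \sum_(i < size g) c i * g`_i].

Definition noetherian : Prop :=
  forall I, ideal I -> exists g : seq R, I = ideal_span g.

(* P 0 `<` P 1 `<` ... `<` P n; the values of P above n are irrelevant. *)
Definition prime_chain (n : nat) (P : nat -> set R) : Prop :=
  (forall i, (i <= n)%N -> prime_ideal (P i)) /\
  (forall i, (i < n)%N -> P i `<` P i.+1).

(* The supremum is taken in the extended integers: +oo when there are
   arbitrarily long chains, -oo for the zero ring. *)
Definition krull_dim : \bar int :=
  supremum -oo%E [set (n%:Z)%:E | n in [set n | exists P : nat -> set R, prime_chain n P]].

End Ideals.

(* Monomials in x_1, x_2, ... ; the index i : nat stands for x_(i+1). *)
Notation monom := {cmonom nat}.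

Definition strict_weak_order (M : Type) (lt : M -> M -> Prop) : Prop :=
  forall f g h, lt f g -> (lt f h \/ lt h g) /\ ~ lt g f.

Definition monomial_preorder (lt : monom -> monom -> Prop) : Prop :=
  [/\ strict_weak_order lt,
      forall f : monom, f <> mone -> lt mone f &
      forall f g h : monom, lt f g <-> lt (mmul f h) (mmul g h)].

Section Dependence.
Variable R : comPzRingType.

(* monalg's evaluation and mpoly's polynomials need a nontrivial ring, while
   {malg R[monom]} is defined for every additive group R; R[x_1, ..., x_s] is
   the part of {malg R[monom]} = R[x_1, x_2, ...] cut out by the following. *)
Definition in_first_vars (s : nat) (f : {malg R[monom]}) : Prop :=
  forall m : monom, m \in msupp f -> forall i : nat, (s <= i)%N -> m i = 0%N.

(* Only meaningful for polynomials in the first s variables. *)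
Definition poly_eval (s : nat) (a : s.-tuple R) (f : {malg R[monom]}) : R :=
  \sum_(m <- msupp f) f@_m * \prod_(i < s) tnth a i ^+ (m i).

Definition initial_form (lt : monom -> monom -> Prop) (f : {malg R[monom]}) :
    {malg R[monom]} :=
  \sum_(m <- msupp f | `[< forall m', m' \in msupp f -> ~ lt m' m >])
    << f@_m *g m >>.

(* m ranges over all monomials, so 0 counts as a coefficient. *)
Definition dependent (lt : monom -> monom -> Prop) (s : nat) (a : s.-tuple R) :
    Prop :=
  exists f : {malg R[monom]},
    [/\ in_first_vars s f,
        poly_eval a f = 0 &
        exists (m : monom) (u : R), (initial_form lt f)@_m * u = 1].

Definition independent (lt : monom -> monom -> Prop) (s : nat)
    (a : s.-tuple R) : Prop :=
  ~ dependent lt a.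

End Dependence.

(* Main.v *)
(* Both parts compare two growth rates of lengths at a prime [P] of [R].
   Localization at [P] is replaced by ideals saturated with respect to the
   complement of [P].

   Lower bound.  Let [C] be the ideal of leading coefficients, for a total
   monomial order, of the relations among [a_1, ..., a_s], and let [P] be minimal
   over [C].  A Noetherian argument replaces the order by a weight [w].  Some
   monomial [a^m0] satisfies [P^e a^m0 <= (a^g : w g > w m0)] locally, hence
   [P^(e k) a^(k m0) <= (a^g : w g >= k (w m0 + 1))], and independence makes the
   [a^m] with [w m < k] define distinct steps of a chain above [P^(e k)]; so the
   length of [R / P^(e k)] grows at least like [k^s].

   Upper bound.  If [P] is minimal over [(a_1, ..., a_s)] and [a^m] is, modulo
   [P], a combination of larger monomials, then only monomials that are not
   divisible by [a^m] matter, and the length of [R / P^k] is [O(k^(s-1))].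

   For (b), [P] is minimal over [C]; since [P] has height less than [s], it is
   minimal over an ideal with [s - 1] generators, so that the two bounds clash.
   For (a), the sequence is chosen so that a prime [Q] minimal over it has height
   at least [s]; a chain of primes below [Q] yields a sequence of length at least
   [s] that is independent for the lexicographic order, whence the lower bound
   at [Q], while a dependence would give the upper bound. *)

Require Import Defs.
From HB Require Import structures.
From mathcomp Require Import all_boot all_order all_algebra.
From mathcomp Require Import finmap monalg.
From mathcomp Require Import boolp classical_sets constructive_ereal.
From mathcomp Require Import zify ring lra.

Set Implicit Arguments.
Unset Strict Implicit.
Unset Printing Implicit Defensive.

Import Order.TTheory GRing.Theory Num.Theory.

Local Open Scope classical_set_scope.
Local Open Scope ring_scope.

(** * Saturated ideals and primes *)

Section IdealTheory.
Variable R : comPzRingType.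
Implicit Types (I J P Q S U X Y : set R) (x y z : R).

(* [U]-saturated ideals: for a multiplicative set [U] these are the ideals of the
   localization of [R] at [U]. *)
Definition sideal U I : Prop :=
  ideal I /\ forall u x, U u -> I (u * x) -> I x.

(** The least [U]-saturated ideal containing [S], encoded as an intersection so that inclusions
    follow by minimality; with [U = [set 1]] it is the ordinary ideal generated by [S]. *)
Variant sgen U S : set R :=
  Sgen x : (forall J, sideal U J -> S `<=` J -> J x) -> sgen U S x.

Definition multset U : Prop := U 1 /\ forall x y, U x -> U y -> U (x * y).

Definition avoids P : set R := [set u | ~ P u].

(* [prod_in n P I] expresses that [P ^ n] is contained in [I]. *)
Definition prod_in (n : nat) P I : Prop :=
  forall l : seq R, size l = n -> (forall x, x \in l -> P x) ->
    I (\prod_(x <- l) x).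

Lemma ideal0 I : ideal I -> I 0. Proof. by case. Qed.
Lemma idealD I x y : ideal I -> I x -> I y -> I (x + y).
Proof. by case=> _ h _; apply: h. Qed.
Lemma idealM I r x : ideal I -> I x -> I (r * x).
Proof. by case=> _ _ h; apply: h. Qed.
Lemma idealMr I r x : ideal I -> I x -> I (x * r).
Proof. by rewrite mulrC; apply: idealM. Qed.
Lemma idealN I x : ideal I -> I x -> I (- x).
Proof. by move=> hI Ix; rewrite -mulN1r; apply: idealM. Qed.
Lemma idealB I x y : ideal I -> I x -> I y -> I (x - y).
Proof. by move=> hI Ix Iy; apply: idealD => //; apply: idealN. Qed.
Lemma ideal_sum I (T : Type) (r : seq T) (A : pred T) (F : T -> R) :
  ideal I -> (forall t, A t -> I (F t)) -> I (\sum_(t <- r | A t) F t).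
Proof.
move=> hI h; elim/big_ind: _ => //; first by apply: ideal0.
by move=> x y; apply: idealD.
Qed.

Lemma sidealW U I : sideal U I -> ideal I. Proof. by case. Qed.
#[local] Hint Extern 0 (ideal _) => (eapply sidealW; eassumption) : core.

Lemma sidealI U I J : sideal U I -> sideal U J -> sideal U (I `&` J).
Proof.
move=> [[I0 ID IM] IU] [[J0 JD JM] JU]; split; last first.
  by move=> u x Uu [Ix Jx]; split; [apply: IU Ix | apply: JU Jx].
by split=> // [x y [? ?] [? ?]|r x [? ?]]; split; auto.
Qed.

Lemma sideal_colon U I x : sideal U I -> sideal U [set r | I (r * x)].
Proof.
move=> [hI IU]; split; first split => /=.
- by rewrite mul0r; apply: ideal0.
- by move=> r s; rewrite mulrDl; apply: idealD.
- by move=> r s; rewrite -mulrA; apply: idealM.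
by move=> u r Uu; rewrite /= -mulrA; apply: IU.
Qed.

Lemma sideal_ideal I : ideal I -> sideal [set 1] I.
Proof. by split=> // u x ->; rewrite mul1r. Qed.

Lemma sub_sgen U S : S `<=` sgen U S.
Proof. by move=> x Sx; split=> J hJ; apply. Qed.

Lemma sgen_min U S J : sideal U J -> S `<=` J -> sgen U S `<=` J.
Proof. by move=> hJ SJ _ [x]; apply. Qed.

Lemma sgen_sideal U S : sideal U (sgen U S).
Proof.
split; first split.
- by split=> J hJ _; apply: ideal0.
- move=> _ _ [x Sx] [y Sy]; split=> J hJ SJ.
  by apply: idealD; [exact: sidealW hJ | apply: Sx | apply: Sy].
- by move=> r _ [x Sx]; split=> J hJ SJ; apply: idealM; [exact: sidealW hJ | apply: Sx].
move=> u x Uu Sx; split=> J hJ SJ; case: (hJ) => _; apply; first exact: Uu.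
exact: sgen_min Sx.
Qed.
Hint Resolve sgen_sideal : core.

Lemma sgen_ideal U S : ideal (sgen U S). Proof. exact: sidealW. Qed.
Hint Resolve sgen_ideal : core.

Lemma sgenS U S S' : S `<=` sgen U S' -> sgen U S `<=` sgen U S'.
Proof. by move=> h; apply: sgen_min. Qed.

Lemma sgen_mono U S S' : S `<=` S' -> sgen U S `<=` sgen U S'.
Proof. by move=> h; apply: sgenS => x /h; apply: sub_sgen. Qed.

(** The elements whose multiple by [z] falls into the target form a saturated ideal, so only
    generators have to be checked. *)
Lemma sgen_mul U S S' z x :
  (forall y, S y -> sgen U S' (y * z)) -> sgen U S x -> sgen U S' (x * z).
Proof.
by move=> h; apply: (sgen_min (sideal_colon z (sgen_sideal U S'))).
Qed.

Lemma sideal_sat U I : multset U -> ideal I ->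
  sideal U [set x | exists2 u, U u & I (u * x)].
Proof.
move=> [U1 UM] hI; split; first split => /=.
- by exists 1 => //; rewrite mulr0; apply: ideal0.
- move=> x y [u Uu Iu] [v Uv Iv]; exists (u * v); first exact: UM.
  have -> : u * v * (x + y) = v * (u * x) + u * (v * y) by ring.
  by apply: idealD => //; apply: idealM.
- move=> r x [u Uu Iu]; exists u => //.
  by rewrite mulrCA; apply: idealM.
by move=> u x Uu [v Uv Iv]; exists (v * u); [exact: UM | rewrite -mulrA].
Qed.

(** Clearing denominators: the elements with some [U]-multiple in the ordinary ideal already form a
    saturated ideal. *)
Lemma sgen1P U S x : multset U -> sgen U S x ->
  exists2 u, U u & sgen [set 1] S (u * x).
Proof.
move=> mU; have hs := sideal_sat mU (sidealW (sgen_sideal [set 1] S)).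
apply: (sgen_min hs) => y Sy; exists 1; first by case: mU.
by rewrite mul1r; apply: sub_sgen.
Qed.

Lemma sgen1_sub U S : sgen [set 1] S `<=` sgen U S.
Proof. by apply: sgen_min; [apply: sideal_ideal; apply: sidealW | apply: sub_sgen]. Qed.

Lemma sgen_addP U S I x : multset U -> ideal I -> sgen U (S `|` I) x ->
  exists u y z, [/\ U u, sgen [set 1] S y, I z & u * x = y + z].
Proof.
move=> mU hI /(sgen1P mU) [u Uu hx].
pose J := [set t | exists y z, [/\ sgen [set 1] S y, I z & t = y + z]].
have hJ : ideal J.
  split.
  - by exists 0, 0; split; [by apply: ideal0|by apply: ideal0|rewrite addr0].
  - move=> t t' [y [z [Sy Iz ->]]] [y' [z' [Sy' Iz' ->]]].
    exists (y + y'), (z + z'); split; last by ring.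
      by apply: idealD.
    by apply: idealD.
  - move=> r t [y [z [Sy Iz ->]]]; exists (r * y), (r * z).
    by split; [by apply: idealM | by apply: idealM | ring].
have [|y [z [Sy Iz e]]] := sgen_min (sideal_ideal hJ) _ hx; last by exists u, y, z.
move=> t [St|It]; first by exists t, 0; rewrite addr0; split => //; [exact: sub_sgen|by apply: ideal0].
by exists 0, t; rewrite add0r; split => //; by apply: ideal0.
Qed.

Lemma sgen_add1P U z I x : multset U -> sideal U I -> sgen U ([set z] `|` I) x ->
  exists u r, [/\ U u & I (u * x - r * z)].
Proof.
move=> mU hI /(sgen_addP mU (sidealW hI)) [u [y [t [Uu Sy It e]]]].
have hJ : ideal [set r * z | r in setT].
  split; first by exists 0 => //; rewrite mul0r.
    by move=> _ _ [r _ <-] [s _ <-]; exists (r + s) => //; rewrite mulrDl.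
  by move=> s _ [r _ <-]; exists (s * r) => //; rewrite mulrA.
case: (sgen_min (sideal_ideal hJ) _ Sy) => [w ->|r _ e']; first by exists 1; rewrite ?mul1r.
by exists u, r; split=> //; rewrite e e' addrC addKr.
Qed.

Section Prime.
Variable P : set R.
Hypothesis hP : prime_ideal P.

Lemma prime_id : ideal P. Proof. by case: hP. Qed.

Lemma prime_multset : multset (avoids P).
Proof. by case: hP => _ P1 PM; split=> // x y Px Py /PM []. Qed.

Lemma prime_prod (T : Type) (r : seq T) (A : pred T) (F : T -> R) :
  (forall t, A t -> ~ P (F t)) -> ~ P (\prod_(t <- r | A t) F t).
Proof.
move=> h; case: prime_multset => U1 UM.
by elim/big_ind: _.
Qed.

Lemma prime_exp x n : P (x ^+ n) -> P x.
Proof.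
case: hP => _ P1 PM; elim: n => [|n IH]; first by rewrite expr0 => /P1.
by rewrite exprS => /PM [].
Qed.

End Prime.

#[local] Hint Extern 0 (ideal _) => (eapply prime_id; eassumption) : core.

(** * Minimal primes, heights and Krull's intersection theorem *)

Section Noetherian.
Hypothesis noeth : noetherian R.

Lemma ideal_acc (I : nat -> set R) : (forall n, ideal (I n)) ->
  (forall n, I n `<=` I n.+1) -> exists n, forall m, I m `<=` I n.
Proof.
move=> hI IS.
have mono m n : (m <= n)%N -> I m `<=` I n.
  elim: n => [|n IH]; first by rewrite leqn0 => /eqP ->.
  by rewrite leq_eqVlt => /orP [/eqP -> //|/IH h x /h /IS].
pose J := [set x | exists n, I n x].
have hJ : ideal J.
  split; first by exists 0%N; apply: ideal0.
    move=> x y [m Ix] [n Iy]; exists (maxn m n); apply: idealD => //.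
      by apply: mono Ix; rewrite leq_maxl.
    by apply: mono Iy; rewrite leq_maxr.
  by move=> r x [n Ix]; exists n; apply: idealM.
have [g gE] := noeth hJ.
have hg i : exists n, (i < size g)%N -> I n g`_i.
  case: (ltnP i (size g)) => [lt|]; last by exists 0%N.
  have : J g`_i.
    rewrite gE; exists (fun j => (j == i)%:R).
    rewrite (bigD1 (Ordinal lt)) //= eqxx mul1r big1 ?addr0 // => j.
    by rewrite -val_eqE /= => /negbTE ->; rewrite mul0r.
  by case=> n In; exists n.
have [f hf] := choice hg.
exists (\max_(i < size g) f i)%N => m x Ix.
have : J x by exists m.
rewrite gE => - [c ->]; apply: ideal_sum => // i _.
by apply: idealM => //; apply: mono (hf i (ltn_ord i)); apply: leq_bigmax_cond.
Qed.

Lemma noeth_ind (K : set R -> Prop) :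
  (forall I, ideal I -> (forall J, ideal J -> I `<` J -> K J) -> K I) ->
  forall I, ideal I -> K I.
Proof.
move=> step I hI; apply: contrapT => nK.
pose T := {J : set R | ideal J /\ ~ K J}.
have nxt (J : T) : exists J' : T, sval J `<` sval J'.
  case: J => J [hJ nKJ] /=; apply: contrapT => h; apply: nKJ.
  apply: step => // J' hJ' JJ'; apply: contrapT => nKJ'.
  by apply: h; exists (exist _ J' (conj hJ' nKJ')).
have [f hf] := choice nxt.
pose seqI n := iter n f (exist _ I (conj hI nK)).
have [|n|n hn] := @ideal_acc (fun n => sval (seqI n)).
- by move=> n; case: (svalP (seqI n)).
- by case: (hf (seqI n)).
by case: (hf (seqI n)) => _; apply; apply: (hn n.+1).
Qed.

Lemma max_ideal (K : set R -> Prop) I : ideal I -> K I ->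
  exists J, [/\ ideal J, K J, I `<=` J &
    forall J', ideal J' -> K J' -> J `<=` J' -> J' `<=` J].
Proof.
move=> hI; move: I hI; apply: noeth_ind => I hI IH KI.
case: (pselect (exists J, [/\ ideal J, K J & I `<` J])) => [[J [hJ KJ IJ]]|h].
  have [J' [hJ' KJ' JJ' m]] := IH J hJ IJ KJ; exists J'; split=> //.
  by apply: subset_trans JJ'; case: IJ.
exists I; split=> // J hJ KJ IJ x Jx; apply: contrapT => nIx.
by apply: h; exists J; split=> //; split=> // h; apply: nIx; apply: h.
Qed.

Lemma ideal_fg I : ideal I -> exists g : seq R,
  (forall x, x \in g -> I x) /\ forall J, ideal J -> (forall x, x \in g -> J x) -> I `<=` J.
Proof.
move=> hI; have [g gE] := noeth hI; exists g; split.
  move=> x /(nthP 0) [i lt <-]; rewrite gE; exists (fun j => (j == i)%:R).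
  rewrite (bigD1 (Ordinal lt)) //= eqxx mul1r big1 ?addr0 // => j.
  by rewrite -val_eqE /= => /negbTE ->; rewrite mul0r.
move=> J hJ h x; rewrite gE => -[c ->]; apply: ideal_sum => // i _.
by apply: idealM => //; apply: h; apply: mem_nth.
Qed.

Lemma sideal_addl U x I : multset U -> ideal I -> ~ I x ->
  I `<` sgen U ([set x] `|` I).
Proof.
move=> mU hI nIx; split; first by move=> y Iy; apply: sub_sgen; right.
by move=> h; apply: nIx; apply: h; apply: sub_sgen; left.
Qed.

Lemma multset1 : multset [set 1 : R].
Proof. by split=> // x y -> ->; rewrite mul1r. Qed.

(** Noetherian induction: if [x * y] lies in [I] but [x] and [y] do not, the primes found above
    [I + (x)] and [I + (y)] are concatenated, because the product of these two ideals lies in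
    [I]. *)
Lemma prime_decomp I : ideal I -> exists n (p : nat -> set R),
  [/\ forall j, (j < n)%N -> prime_ideal (p j),
      forall j, (j < n)%N -> I `<=` p j &
      forall x : nat -> R, (forall j, (j < n)%N -> p j (x j)) ->
        I (\prod_(j < n) x j)].
Proof.
move: I; apply: noeth_ind => I hI IH.
case: (pselect (I 1)) => [I1|nI1].
  exists 0%N, (fun=> I); split=> // x _; first by rewrite big_ord0.
case: (pselect (prime_ideal I)) => [pI|npI].
  by exists 1%N, (fun=> I); split=> [//|j _ x //|x h]; rewrite big_ord1; apply: h.
have [x [y [Ixy nx ny]]] : exists x y, [/\ I (x * y), ~ I x & ~ I y].
  apply: contrapT => h; apply: npI; split=> // x y Ixy.
  by case: (pselect (I x)); [left|right; apply: contrapT => ny; apply: h; exists x, y].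
have ext z : ~ I z -> exists n (p : nat -> set R),
  [/\ forall j, (j < n)%N -> prime_ideal (p j),
      forall j, (j < n)%N -> I `<=` p j &
      forall a : nat -> R, (forall j, (j < n)%N -> p j (a j)) ->
        exists r, I (\prod_(j < n) a j - r * z)].
  move=> nz; have [|n [p [h1 h2 h3]]] := IH (sgen [set 1] ([set z] `|` I)) _ (sideal_addl multset1 hI nz).
    exact: sidealW.
  exists n, p; split=> //.
    by move=> j lt t It; apply: h2 => //; apply: sub_sgen; right.
  move=> a /h3 /(sgen_add1P multset1 (sideal_ideal hI)) [u [r [-> h]]].
  by exists r; rewrite mul1r in h.
have [n1 [p1 [a1 b1 c1]]] := ext _ nx.
have [n2 [p2 [a2 b2 c2]]] := ext _ ny.
exists (n1 + n2)%N, (fun j => if (j < n1)%N then p1 j else p2 (j - n1)%N).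
have aux j : (j < n1 + n2)%N -> ~~ (j < n1)%N -> (j - n1 < n2)%N by lia.
split.
- by move=> j lt; case: ifPn => [/a1 //|/(aux _ lt) /a2].
- by move=> j lt; case: ifPn => [/b1 //|/(aux _ lt) /b2].
move=> a ha; rewrite big_split_ord /=.
have [|r hr] := c1 a.
  by move=> j lt; have := ha j (ltn_addr _ lt); rewrite lt.
have [|s hs] := c2 (fun j => a (n1 + j)%N).
  move=> j lt; have := ha (n1 + j)%N; rewrite ltn_add2l lt => /(_ isT).
  by rewrite ltnNge leq_addr /= addKn.
set A := \prod_(_ < n1) _ in hr *; set B := \prod_(_ < n2) _ in hs *.
have -> : A * B = (A - r * x) * B + r * x * (B - s * y) + r * s * (x * y) by ring.
by apply: idealD => //; [apply: idealD => //; [apply: idealMr|apply: idealM] | apply: idealM].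
Qed.

(** A product of elements chosen in the [p j] but outside [Q] would be in [I] and not in [Q]. *)
Lemma prime_above_factor I n (p : nat -> set R) Q : prime_ideal Q -> I `<=` Q ->
  (forall x : nat -> R, (forall j, (j < n)%N -> p j (x j)) -> I (\prod_(j < n) x j)) ->
  exists2 j, (j < n)%N & p j `<=` Q.
Proof.
move=> pQ IQ h; apply: contrapT => no.
have hx j : exists x, (j < n)%N -> p j x /\ ~ Q x.
  case: (ltnP j n) => [lt|]; last by exists 0.
  apply: contrapT => nx; apply: no; exists j => // x px.
  by apply: contrapT => nQ; apply: nx; exists x.
have [x {}hx] := choice hx.
have /IQ := h x (fun j lt => (hx j lt).1).
by apply: prime_prod => // i _; case: (hx i (ltn_ord i)).
Qed.

Definition minimal_over I P : Prop :=
  forall Q, prime_ideal Q -> I `<=` Q -> Q `<=` P -> P `<=` Q.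

Lemma minimal_prime I Q : ideal I -> prime_ideal Q -> I `<=` Q ->
  exists P, [/\ prime_ideal P, I `<=` P, P `<=` Q & minimal_over I P].
Proof.
move=> hI pQ IQ; have [n [p [hp Ip hprod]]] := prime_decomp hI.
have [j0 lt0 pQ0] := prime_above_factor pQ IQ hprod.
(* Every prime above [I] contains one of the [p j], so it suffices to minimize among these; the
   number of [p i] below [p j] drops when [p j] is replaced by a strictly smaller one. *)
pose c (j : 'I_n) := #|[pred i : 'I_n | `[< p i `<=` p j >]]|.
case: (@arg_minnP _ (Ordinal lt0) (fun j => `[< p j `<=` Q >]) c).
  exact/asboolP.
move=> j /asboolP pjQ jmin; exists (p j); split=> //; [exact: hp|exact: Ip|].
move=> Q' pQ' IQ' Q'j.
have [i lti piQ'] := prime_above_factor pQ' IQ' hprod.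
have pij := subset_trans piQ' Q'j.
suff : p j `<=` p i by move/subset_trans; apply.
have /= := jmin (Ordinal lti) (introT (asboolP _) (subset_trans pij pjQ)).
apply: contraPP => nji; apply/negP; rewrite -ltnNge; apply: proper_card.
have mono a b k : p a `<=` p b -> `[< p k `<=` p a >] -> `[< p k `<=` p b >].
  by move=> ab /asboolP h; apply/asboolP; apply: subset_trans ab.
apply/properP; split.
  by apply/fintype.subsetP => k; apply: mono.
exists j; first by apply/asboolP.
by apply/negP => /asboolP.
Qed.

Lemma exists_prime I : ideal I -> ~ I 1 -> exists2 P, prime_ideal P & I `<=` P.
Proof.
move=> hI nI1; have [[|n] [p [hp Ip hprod]]] := prime_decomp hI.
  by case: nI1; have := hprod (fun=> 0); rewrite big_ord0; apply.
by exists (p 0%N); [exact: hp | exact: Ip].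
Qed.

(** A factor [p j] either has an element outside [P], which goes into the denominator [u], or
    contains [P] by minimality. Thus [I] contains a power of [P] locally. *)
Lemma minimal_nilpotent I P : ideal I -> prime_ideal P -> minimal_over I P ->
  exists n, exists2 u, ~ P u & forall l : seq R, size l = n ->
    (forall x, x \in l -> P x) -> I (u * \prod_(x <- l) x).
Proof.
move=> hI pP minP; have [n [p [hp Ip hprod]]] := prime_decomp hI.
have hu j : exists u, ~ P u /\ ((j < n)%N -> p j u \/ P `<=` p j).
  case: (ltnP j n) => [lt|]; last by exists 1; split=> //; case: pP.
  case: (pselect (exists2 u, ~ P u & p j u)) => [[u nPu pu]|h].
    by exists u; split=> // _; left.
  exists 1; split; first by case: pP.
  move=> _; right; apply: minP; [exact: hp|exact: Ip|].
  by move=> x px; apply: contrapT => nPx; apply: h; exists x.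
have [u {}hu] := choice hu.
exists n, (\prod_(j < n) u j).
  by apply: prime_prod => // i _; case: (hu i).
move=> l sl hl; rewrite (big_nth 0) big_mkord sl -big_split /=.
apply: (hprod (fun j => u j * l`_j)) => j lt.
have pj := prime_id (hp _ lt).
case: (hu j) => _ /(_ lt) [pu|Pp]; first by apply: idealMr.
by apply: idealM => //; apply: Pp; apply: hl; apply: mem_nth; rewrite sl.
Qed.

Lemma prime_avoidance P n (p : nat -> set R) : ideal P ->
  (forall j, (j < n)%N -> prime_ideal (p j) /\ ~ P `<=` p j) ->
  exists2 x, P x & forall j, (j < n)%N -> ~ p j x.
Proof.
move=> hP; elim: n => [|n IH] h; first by exists 0 => //; apply: ideal0.
have [j lt|x Px hx] := IH; first by apply: h; apply: ltnW.
case: (pselect (p n x)) => [px|npx]; last first.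
  by exists x => // j; rewrite ltnS leq_eqVlt => /orP [/eqP ->|/hx].
have [pn nPn] := h n (leqnn _).
have [z Pz nz] : exists2 z, P z & ~ p n z.
  apply: contrapT => no; apply: nPn => z Pz; apply: contrapT => nz.
  by apply: no; exists z.
have ht j : exists t, ~ p n t /\ (p j t \/ p j `<=` p n).
  case: (pselect (p j `<=` p n)) => [s|ns].
    by exists 1; split; [case: pn | right].
  apply: contrapT => no; apply: ns => t pt; apply: contrapT => nt.
  by apply: no; exists t; split=> //; left.
have [t {}ht] := choice ht.
(* [x + z * T] differs from [x] by an element of each [p j] not below [p n], and
   lies outside [p n], hence outside the [p j] below [p n]. *)
pose T := \prod_(j < n) t j.
have nT : ~ p n (z * T).
  case: (pn) => _ _ /(_ z T) h' /h' [//|].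
  by apply: prime_prod => // i _; case: (ht i).
have nx : ~ p n (x + z * T).
  move=> hn; apply: nT; rewrite -[_ * _](addKr x) addrC.
  by apply: idealB (prime_id pn) _ _.
exists (x + z * T); first by apply: idealD => //; apply: idealMr.
move=> j; rewrite ltnS leq_eqVlt => /orP [/eqP -> //|lt].
case: (ht j) => _ [pt|s]; last by move/s.
move=> hj; apply: (hx j lt).
have pj := prime_id (h j (ltnW lt)).1.
rewrite -[x](addrK (z * T)); apply: idealB => //.
apply: idealM => //; rewrite /T (bigD1 (Ordinal lt)) //=.
by apply: idealMr.
Qed.

Definition height_ge P (n : nat) : Prop :=
  exists2 p : nat -> set R, prime_chain n p & p n = P.

Lemma height_ge_succ P Q n : height_ge P n -> prime_ideal Q -> P `<` Q ->
  height_ge Q n.+1.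
Proof.
move=> [p [hp inc] pn] pQ PQ.
exists (fun i => if (i <= n)%N then p i else Q); last by rewrite ltnn.
split=> [i|i].
  by move=> _; case: leqP => [/hp|].
rewrite ltnS => le; rewrite le; case: ltnP => [/inc //|ge].
by have -> : i = n by [apply/eqP; rewrite eqn_leq le]; rewrite pn.
Qed.

Lemma height_ge0 P : prime_ideal P -> height_ge P 0.
Proof. by exists (fun=> P). Qed.

(** Each new element avoids those primes over the previous elements that do not contain [P], so a
    prime containing it as well lies strictly above one of them and gains one in height: a converse
    of Krull's height theorem. *)
Lemma height_sequence P n : prime_ideal P -> exists b : nat -> R,
  (forall i, P (b i)) /\
  forall Q, prime_ideal Q -> (forall i, (i < n)%N -> Q (b i)) ->
    P `<=` Q \/ height_ge Q n.
Proof.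
move=> pP; elim: n => [|n [b [Pb hb]]].
  exists (fun=> 0); split; first by move=> _; apply: ideal0; apply: prime_id.
  by move=> Q pQ _; right; apply: height_ge0.
pose I := sgen [set 1] [set x | exists2 i, (i < n)%N & x = b i].
have hI : ideal I by exact: sgen_ideal.
have [m [p [hp Ip hprod]]] := prime_decomp hI.
case: (pselect (exists2 j, (j < m)%N & ~ P `<=` p j)) => [[j0 lt0 nj0]|no]; last first.
  exists b; split=> // Q pQ hQ; left.
  have IQ : I `<=` Q.
    apply: sgen_min; first by apply: sideal_ideal; apply: prime_id.
    by move=> _ [i lt ->]; apply: hQ; apply: ltnW.
  have [j lt jQ] := prime_above_factor pQ IQ hprod.
  apply: subset_trans jQ; apply: contrapT => nj; apply: no; by exists j.
(* Only the [p j] that do not contain [P] can be avoided; the other ones are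
   replaced by [p j0]. *)
pose q j := if `[< P `<=` p j >] then p j0 else p j.
have [|c Pc hc] := @prime_avoidance P m q (prime_id pP).
  by move=> j lt; rewrite /q; case: asboolP => [_|nj]; split=> //; apply: hp.
exists (fun i => if (i < n)%N then b i else c); split.
  by move=> i; case: ifP.
move=> Q pQ hQ.
have IQ : I `<=` Q.
  apply: sgen_min; first by apply: sideal_ideal; apply: prime_id.
  by move=> _ [i lt ->]; have := hQ i (ltnW lt); rewrite lt.
have [j lt jQ] := prime_above_factor pQ IQ hprod.
case: (pselect (P `<=` p j)) => [Pj|nPj]; first by left; apply: subset_trans jQ.
right; apply: height_ge_succ (pQ) _; last first.
  split; first exact: jQ.
  move=> Qj; have := hc j lt; rewrite /q; case: asboolP => // _; apply; apply: Qj.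
  by have := hQ n (leqnn _); rewrite ltnn.
have [|//|//] := hb (p j) (hp _ lt).
by move=> i lti; apply: Ip => //; apply: sub_sgen; exists i.
Qed.

(** Induction on the generators of [P]: a long product of factors [r * a + y] expands into terms
    with either a high power of [a] or many factors in the ideal of the other generators. *)
Lemma prod_in_radical U P Q : ideal P -> sideal U Q ->
  (forall x, P x -> exists n, Q (x ^+ n)) -> exists n, prod_in n P Q.
Proof.
move=> hP hQ hx; have [g [gP gmin]] := ideal_fg hP.
pose good (h : seq R) := exists n, forall l : seq R, (n <= size l)%N ->
  (forall J, ideal J -> (forall x, x \in h -> J x) -> forall x, x \in l -> J x) ->
  Q (\prod_(x <- l) x).
suff [n hn] : good g.
  exists n => l sl hl; apply: hn; first by rewrite sl.
  by move=> J hJ hJg x /hl; apply: gmin.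
elim: g gP {gmin} => [|a g IH] gP.
  exists 1%N => -[//|y l] _ h; rewrite big_cons.
  have -> : y = 0; last by rewrite mul0r; apply: ideal0 (sidealW hQ).
  apply: (h [set 0]) => //; last exact: mem_head.
  by split=> // [x y' -> ->|r x ->]; rewrite ?addr0 ?mulr0.
have [|n hn] := IH; first by move=> x xg; apply: gP; rewrite inE xg orbT.
have [m hm] := hx a (gP a (mem_head _ _)).
exists (m + n)%N => l.
pose Ig := sgen [set 1] [set x | x \in g].
have hIg : ideal Ig by exact: sgen_ideal.
move=> sl hl.
have {hl}hl x : x \in l -> exists r y, x = r * a + y /\ Ig y.
  move=> xl; pose J := [set x | exists r y, x = r * a + y /\ Ig y].
  apply: (hl J) => //.
    split; first by exists 0, 0; split; [ring | apply: ideal0].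
      move=> _ _ [r [y [-> hy]]] [s [z [-> hz]]]; exists (r + s), (y + z).
      by split; [ring | apply: idealD].
    move=> t _ [r [y [-> hy]]]; exists (t * r), (t * y).
    by split; [ring | apply: idealM].
  move=> z; rewrite inE => /orP [/eqP ->|zg].
    by exists 1, 0; split; [ring | apply: ideal0].
  by exists 0, z; split; [ring | apply: sub_sgen].
(* [k] counts the factors [a] already extracted, [l1] holds the factors still to be expanded, and
   [l2] the parts chosen in [Ig]. *)
suff H : forall k (l1 l2 : seq R), (forall x, x \in l1 -> exists r y, x = r * a + y /\ Ig y) ->
    (forall x, x \in l2 -> Ig x) -> (m + n <= k + size l1 + size l2)%N ->
    Q (a ^+ k * (\prod_(x <- l1) x * \prod_(x <- l2) x)).
  have := H 0%N l [::] hl; rewrite big_nil expr0 mul1r mulr1; apply=> //=.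
  by rewrite addn0.
move=> k l1; elim: l1 k => [|x l1 IHl] k l2 h1 h2 sz.
  rewrite big_nil mul1r; case: (leqP m k) => [le|gt].
    by rewrite -(subnK le) exprD; apply: idealMr => //; apply: idealM.
  apply: idealM; first exact: sidealW hQ.
  apply: hn; first by move: sz => /=; lia.
  move=> J hJ hJg x /h2; apply: sgen_min; first exact: sideal_ideal.
  by move=> y; apply: hJg.
have [r [y [xE hy]]] := h1 x (mem_head _ _).
have h1' z : z \in l1 -> exists r y, z = r * a + y /\ Ig y.
  by move=> zl; apply: h1; rewrite inE zl orbT.
have A := IHl k.+1 l2 h1' h2; have B := IHl k (y :: l2) h1'.
rewrite big_cons {}xE.
have -> : forall L1 L2, a ^+ k * ((r * a + y) * L1 * L2) =
  r * (a ^+ k.+1 * (L1 * L2)) + a ^+ k * (L1 * (y * L2)) by move=> L1 L2; rewrite exprS; ring.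
apply: idealD; first exact: sidealW hQ.
  apply: idealM; first exact: sidealW hQ.
  by apply: A; move: sz => /=; lia.
rewrite big_cons in B; apply: B; last by move: sz => /=; lia.
by move=> z; rewrite inE => /orP [/eqP ->|/h2].
Qed.

(* Krull's intersection theorem for the localization at [P].  A saturated ideal
   [Q] maximal among those above [I] that avoid [y] contains a power of [P]. *)
Lemma krull_intersection P I y : prime_ideal P -> sideal (avoids P) I ->
  (forall n J, sideal (avoids P) J -> I `<=` J -> prod_in n P J -> J y) -> I y.
Proof.
move=> pP hI hy; apply: contrapT => nIy.
have mU := prime_multset pP.
have [Q [_ [hQ nQy] IQ Qmax]] :=
  @max_ideal (fun J => sideal (avoids P) J /\ ~ J y) I (sidealW hI) (conj hI nIy).
have key z : ~ Q z -> exists2 u, ~ P u & exists r, Q (u * y - r * z).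
  move=> nQz; have : sgen (avoids P) ([set z] `|` Q) y.
    apply: contrapT => ny; apply: nQz.
    apply: (Qmax _ _ (conj (sgen_sideal _ _) ny)); first exact: sidealW.
      by move=> x Qx; apply: sub_sgen; right.
    by apply: sub_sgen; left.
  by move=> /(sgen_add1P mU hQ) [u [r [Uu h]]]; exists u => //; exists r.
(* Otherwise [u * y - r * (x * y)] lies in [Q] by maximality; since [u - r * x] is outside [P],
   saturation puts [y] into [Q]. *)
have Py x : P x -> Q (x * y).
  move=> Px; apply: contrapT => /key [u nPu [r h]]; apply: nQy.
  case: (hQ) => _ /(_ (u - r * x) y); apply; last by rewrite mulrBl -mulrA.
  move=> h'; apply: nPu; rewrite -[u](subrK (r * x)).
  by apply: idealD => //; apply: idealM.
have [|n hn] := @prod_in_radical (avoids P) P Q (prime_id pP) hQ.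
  move=> x Px.
  (* Once this chain is stationary, a relation [u * y - r * x ^+ n.+1] in [Q] can be multiplied by
     [x ^+ n.+1]: as [x * y] lies in [Q], so does [x ^+ n.+1 * r], hence [u * y]. *)
  pose A n := [set z | Q (x ^+ n.+1 * z)].
  have hA n : sideal (avoids P) (A n).
    by have := sideal_colon (x ^+ n.+1) hQ; under eq_set do rewrite mulrC.
  have AS n : A n `<=` A n.+1.
    by move=> z; rewrite /A /= [x ^+ n.+2]exprS -mulrA; apply: idealM (sidealW hQ).
  have [n hn] := ideal_acc (fun n => sidealW (hA n)) AS.
  exists n.+1; apply: contrapT => /key [u nPu [r h]]; apply: nQy.
  case: (hQ) => hQi /(_ u y); apply=> //.
  have : A n r.
    apply: (hn (n + n.+1)%N); rewrite /A /=.
    have -> : x ^+ (n + n.+1).+1 * r = x ^+ n.+1 * (r * x ^+ n.+1).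
      by rewrite -addSn exprD; ring.
    have -> : x ^+ n.+1 * (r * x ^+ n.+1) =
       u * x ^+ n * (x * y) - x ^+ n.+1 * (u * y - r * x ^+ n.+1).
      by rewrite exprS; ring.
    by apply: idealB => //; apply: idealM => //; apply: Py.
  move=> Ar; have -> : u * y = (u * y - r * x ^+ n.+1) + x ^+ n.+1 * r by ring.
  by apply: idealD.
by apply: nQy; apply: hy hn.
Qed.

End Noetherian.
End IdealTheory.

(** * Exponent vectors and weights *)

Section Exponents.
Variable s : nat.

Definition vec := {ffun 'I_s -> nat}.
Implicit Types (f g h m n : vec) (w : 'I_s -> nat).

Definition unitv (i : 'I_s) : vec := [ffun j => (j == i) : nat].

Definition wt w m : nat := (\sum_i w i * m i)%N.

Lemma vecD m n i : (m + n) i = (m i + n i)%N. Proof. by rewrite ffunE. Qed.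
Lemma vec0 i : (0 : vec) i = 0%N. Proof. by rewrite ffunE. Qed.
Lemma vecMn m k i : (m *+ k) i = (m i * k)%N.
Proof.
elim: k => [|k IH]; first by rewrite mulr0n vec0 muln0.
by rewrite mulrS vecD IH mulnS.
Qed.

Lemma vec_le m n : (forall i, m i <= n i)%N -> exists p, n = m + p.
Proof.
move=> h; exists [ffun i => (n i - m i)%N]; apply/ffunP => i.
by rewrite vecD ffunE subnKC.
Qed.

Lemma wtD w m n : wt w (m + n) = (wt w m + wt w n)%N.
Proof. by rewrite /wt -big_split; apply: eq_bigr => i _; rewrite vecD mulnDr. Qed.

Lemma wtMn w m k : wt w (m *+ k) = (wt w m * k)%N.
Proof. by rewrite /wt big_distrl; apply: eq_bigr => i _; rewrite vecMn mulnA. Qed.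

Lemma wt_unitv w i : wt w (unitv i) = w i.
Proof.
rewrite /wt (bigD1 i) //= ffunE eqxx muln1 big1 ?addn0 // => j /negbTE ne.
by rewrite ffunE ne muln0.
Qed.

Lemma leq_wt w m i : (0 < w i)%N -> (m i <= wt w m)%N.
Proof.
move=> wi; rewrite /wt (bigD1 i) //=; apply: leq_trans (leq_addr _ _).
exact: leq_pmull.
Qed.

Definition wpreorder (lt : vec -> vec -> Prop) : Prop :=
  [/\ strict_weak_order lt, forall f, f <> 0 -> lt 0 f &
      forall f g h, lt f g <-> lt (f + h) (g + h)].

Definition torder (lt : vec -> vec -> Prop) : Prop :=
  wpreorder lt /\ forall f g, f <> g -> lt f g \/ lt g f.

Section Preorder.
Variable lt : vec -> vec -> Prop.
Hypothesis wlt : wpreorder lt.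

(** Strict ([true]) and weak ([false]) comparison in one relation: when comparisons are composed or
    added, their flags combine by [||]. *)
Definition rel (b : bool) f g : Prop := if b then lt f g else ~ lt g f.

Lemma mlt_asym f g : lt f g -> ~ lt g f.
Proof. by case: wlt => swo _ _ /swo - /(_ f) []. Qed.

Lemma mlt_irr f : ~ lt f f. Proof. by move=> h; apply: (mlt_asym h). Qed.

Lemma mlt_trans f g h : lt f g -> lt g h -> lt f h.
Proof.
case: wlt => swo _ _ fg gh; have [[//|hg] _] := swo _ _ h fg.
by case: (mlt_asym gh).
Qed.

Lemma mlt_add2r f g h : lt f g -> lt (f + h) (g + h).
Proof. by case: wlt => _ _ c; rewrite -c. Qed.

Lemma mlt_addr m p : p <> 0 -> lt m (m + p).
Proof.
by case: wlt => _ pos _ /pos /mlt_add2r - /(_ m); rewrite add0r addrC.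
Qed.

Lemma rel_trans b c f g h : rel b f g -> rel c g h -> rel (b || c) f h.
Proof.
case: wlt => swo _ _.
case: b; case: c => /= fg gh.
- exact: mlt_trans gh.
- by have [[]] := swo _ _ h fg.
- by have [[]] := swo _ _ f gh.
- by move=> hf; have [[]] := swo _ _ g hf.
Qed.

Lemma rel_add2r b f g h : rel b f g -> rel b (f + h) (g + h).
Proof. by case: wlt => _ _ c; case: b => /=; rewrite -c. Qed.

Lemma rel_add b c f g f' g' : rel b f g -> rel c f' g' ->
  rel (b || c) (f + f') (g + g').
Proof.
move=> h h'; apply: rel_trans (rel_add2r f' h) _.
by rewrite ![g + _]addrC; apply: rel_add2r.
Qed.

Lemma rel_muln b f g k : (0 < k)%N -> rel b f g -> rel b (f *+ k) (g *+ k).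
Proof.
case: k => // k _ h; elim: k => [|k IH]; first by rewrite !mulr1n.
by rewrite mulrSr [g *+ _]mulrSr -[b]orbb; apply: rel_add.
Qed.

End Preorder.

(** * Linear inequalities over the rationals and compatible weights *)

Lemma interp (Lo Up : seq (rat * bool)) :
  (forall x y, x \in Lo -> y \in Up ->
     if x.2 || y.2 then x.1 < y.1 else x.1 <= y.1) ->
  exists t, (forall x, x \in Lo -> if x.2 then x.1 < t else x.1 <= t) /\
            (forall y, y \in Up -> if y.2 then t < y.1 else t <= y.1).
Proof.
have extr (L : seq (rat * bool)) (sg : rat) : L != [::] ->
    exists2 x, x \in L & forall y, y \in L -> sg * y.1 <= sg * x.1.
  elim: L => // x [|y L] IH _.
    by exists x; rewrite ?mem_head // => y; rewrite inE => /eqP ->.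
  have [//|z zL zmax] := IH; have [le|lt] := lerP (sg * z.1) (sg * x.1).
    exists x; rewrite ?mem_head // => t; rewrite inE => /orP [/eqP -> //|/zmax h].
    exact: le_trans le.
  exists z; first by rewrite inE zL orbT.
  by move=> t; rewrite inE => /orP [/eqP ->|/zmax //]; apply: ltW.
move=> H; case: (eqVneq Lo [::]) => [->|/(extr _ 1) [M ML Mmax]].
  case: (eqVneq Up [::]) => [->|/(extr _ (-1)) [m mU mmin]]; first by exists 0.
  exists (m.1 - 1); split=> // y /mmin; case: ifP => _; lra.
case: (eqVneq Up [::]) => [->|/(extr _ (-1)) [m mU mmin]].
  exists (M.1 + 1); split=> // y /Mmax; case: ifP => _; lra.
(* If the greatest lower and the least upper bound coincide, no bound attaining this value is
   strict, so the midpoint works in all cases. *)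
exists ((M.1 + m.1) / 2); have hMm := H M m ML mU; split.
  move=> x xL; have := H x m xL mU; have := Mmax x xL.
  by move: hMm; case: (x.2) => /=; case: (m.2); case: (M.2) => /=; lra.
move=> y yU; have := H M y ML yU; have := mmin y yU.
by move: hMm; case: (y.2) => /=; case: (m.2); case: (M.2) => /=; lra.
Qed.

Definition dot (w : 'I_s -> rat) (d : {ffun 'I_s -> int}) : rat :=
  \sum_i w i * (d i)%:~R.

Lemma dotD (w : 'I_s -> rat) d d' : dot w (d + d') = dot w d + dot w d'.
Proof.
by rewrite /dot -big_split; apply: eq_bigr => i _; rewrite ffunE rmorphD mulrDr.
Qed.

Lemma dotMn (w : 'I_s -> rat) d k : dot w (d *+ k) = dot w d *+ k.
Proof.
elim: k => [|k IH]; last by rewrite !mulrS dotD IH.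
by rewrite /dot big1 // => i _; rewrite ffunE mulr0.
Qed.

(* Fourier-Motzkin elimination; the predicate [S] plays the role of the cone
   generated by the constraints. *)
Lemma fourier_motzkin (S : bool -> {ffun 'I_s -> int} -> Prop) :
  (forall b c d d' p q, (0 < p)%N -> (0 < q)%N -> S b d -> S c d' ->
     S (b || c) (d *+ p + d' *+ q)) ->
  ~ S true 0 ->
  forall L : seq (bool * {ffun 'I_s -> int}),
  (forall x, x \in L -> S x.1 x.2) ->
  exists w : 'I_s -> rat, forall x, x \in L -> if x.1 then 0 < dot w x.2 else 0 <= dot w x.2.
Proof.
move=> SD S0.
(* Induction on the number [n] of coordinates in which the constraints may be non-zero. *)
suff H (n : nat) : (n <= s)%N -> forall L : seq (bool * {ffun 'I_s -> int}),
  (forall x, x \in L -> S x.1 x.2 /\ forall i : 'I_s, (n <= i)%N -> x.2 i = 0) ->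
  exists w : 'I_s -> rat, forall x, x \in L -> if x.1 then 0 < dot w x.2 else 0 <= dot w x.2.
  move=> L hL; apply: (H s) => // x /hL Sx; split=> // i.
  by rewrite leqNgt ltn_ord.
elim: n => [_|n IH lt] L hL.
  exists (fun=> 0) => -[[] d] /hL /= [Sd d0].
    by case: S0; have <- : d = 0 by apply/ffunP => i; rewrite d0 // ffunE.
  by rewrite /dot big1 // => i _; rewrite mul0r.
pose i0 := Ordinal lt.
(* The multiples make coordinate [i0] cancel when its entries in [x] and [y] have opposite signs. *)
pose comb (x y : bool * {ffun 'I_s -> int}) : bool * {ffun 'I_s -> int} :=
  (x.1 || y.1, x.2 *+ `|y.2 i0|%N + y.2 *+ `|x.2 i0|%N).
pose Z := [seq x : bool * {ffun 'I_s -> int} <- L | x.2 i0 == 0].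
pose Po := [seq x : bool * {ffun 'I_s -> int} <- L | 0 < x.2 i0].
pose Ne := [seq x : bool * {ffun 'I_s -> int} <- L | x.2 i0 < 0].
have mulE (d : {ffun 'I_s -> int}) k i : (d *+ k) i = d i *+ k.
  by elim: k => [|k IHk]; rewrite ?mulr0n ?ffunE // mulrS ffunE IHk mulrS.
have mz (k : int) (m : nat) : k *+ m = k * m%:Z by rewrite -mulr_natr natz.
have [|w hw] := IH (ltnW lt) (Z ++ [seq comb x y | x <- Po, y <- Ne]).
  move=> x; rewrite mem_cat => /orP [|/allpairsP [[y z] /= [+ + ->]]].
    rewrite mem_filter => /andP [/eqP x0 /hL [Sx x1]]; split=> // i.
    rewrite leq_eqVlt => /orP [/eqP e|]; last exact: x1.
    by have -> : i = i0 by apply: val_inj.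
  rewrite !mem_filter => /andP [y0 /hL [Sy y1]] /andP [z0 /hL [Sz z1]] /=.
  split; first by apply: SD => //; rewrite absz_gt0; [exact: ltr0_neq0|exact: lt0r_neq0].
  move=> i; rewrite leq_eqVlt => /orP [/eqP e|lti]; last first.
    by rewrite ffunE !mulE (y1 _ lti) (z1 _ lti) !mul0rn.
  have -> : i = i0 by apply: val_inj.
  by rewrite ffunE !mulE !mz (gtz0_abs y0) (ltz0_abs z0); ring.
pose A (d : {ffun 'I_s -> int}) := \sum_(i | i != i0) w i * (d i)%:~R.
have dotE d : dot w d = w i0 * (d i0)%:~R + A d by rewrite /dot (bigD1 i0).
(* With the other weights fixed, constraints with a positive entry at [i0] bound the remaining
   weight from below, those with a negative entry from above. *)
have [|t [tLo tUp]] := @interp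
   [seq (- A x.2 / (x.2 i0)%:~R, x.1) | x <- Po]
   [seq (- A x.2 / (x.2 i0)%:~R, x.1) | x <- Ne].
  move=> _ _ /mapP [x xP ->] /mapP [y yN ->] /=.
  have : comb x y \in Z ++ [seq comb x y | x <- Po, y <- Ne].
    by rewrite mem_cat; apply/orP; right; apply/allpairsP; exists (x, y).
  move/hw => /=; rewrite dotD !dotMn !dotE.
  move: xP yN; rewrite !mem_filter => /andP [x0 _] /andP [y0 _].
  have xE (k : rat) : k *+ `|x.2 i0| = k * (x.2 i0)%:~R.
    by rewrite -[in RHS](gtz0_abs x0) -mulr_natr.
  have yE (k : rat) : k *+ `|y.2 i0| = - (k * (y.2 i0)%:~R).
    by rewrite -[y.2 i0 in RHS]opprK -(ltz0_abs y0) rmorphN mulrN opprK -mulr_natr.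
  rewrite {}xE {}yE.
  have {}x0 : 0 < (x.2 i0)%:~R :> rat by rewrite ltr0z.
  have {}y0 : (y.2 i0)%:~R < 0 :> rat by rewrite ltrz0.
  move: (A x.2) (A y.2) (_%:~R) (_%:~R) (w i0) x0 y0 => a b xx yy wi x0 y0.
  by case: ifP => _ h; [rewrite ltr_pdivrMr // mulrAC ltr_ndivlMr // | rewrite ler_pdivrMr // mulrAC ler_ndivlMr //]; lra.
exists (fun i => if i == i0 then t else w i) => x xL.
have -> : dot (fun i => if i == i0 then t else w i) x.2 = t * (x.2 i0)%:~R + A x.2.
  rewrite /dot (bigD1 i0) //= eqxx; congr (_ + _).
  by apply: eq_bigr => i /negbTE ->.
have [x0|x0|x0] := ltgtP (x.2 i0) 0.
- have := tUp (- A x.2 / (x.2 i0)%:~R, x.1); rewrite map_f ?mem_filter ?x0 // => /(_ isT) /=.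
  have {}x0 : (x.2 i0)%:~R < 0 :> rat by rewrite ltrz0.
  by case: ifP => _; rewrite ?ltr_ndivlMr ?ler_ndivlMr //; lra.
- have := tLo (- A x.2 / (x.2 i0)%:~R, x.1); rewrite map_f ?mem_filter ?x0 // => /(_ isT) /=.
  have {}x0 : 0 < (x.2 i0)%:~R :> rat by rewrite ltr0z.
  by case: ifP => _; rewrite ?ltr_pdivrMr ?ler_pdivrMr //; lra.
have := hw x; rewrite mem_cat mem_filter x0 eqxx xL => /(_ isT).
by rewrite /dot (bigD1 i0) //= x0 !mulr0 !add0r.
Qed.

Lemma clear_denominators (w : 'I_s -> rat) : (forall i, 0 < w i) ->
  exists (N : rat) (v : 'I_s -> nat), 0 < N /\ forall i, (v i)%:R = N * w i.
Proof.
move=> w0; exists (\prod_i (denq (w i))%:~R).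
exists (fun i => absz (numq (w i) * \prod_(j | j != i) denq (w j))%R); split.
  by apply: prodr_gt0 => i _; rewrite ltr0z denq_gt0.
move=> i; pose D := \prod_(j | j != i) denq (w j); rewrite -/D (bigD1 i) //=.
have -> : \prod_(j | j != i) (denq (w j))%:~R = D%:~R :> rat by rewrite rmorph_prod.
have nD : 0 <= numq (w i) * D.
  rewrite mulr_ge0 ?numq_ge0 ?[0 <= w i]ltW //.
  by apply: prodr_ge0 => j _; apply: denq_ge0.
by rewrite pmulrn gez0_abs // rmorphM /= numqE; ring.
Qed.

(** Differences of comparable vectors are closed under positive combinations, and a strict one never
    vanishes; so Fourier-Motzkin elimination yields a rational solution, which is then made
    integral. *)
Lemma weights (lt : vec -> vec -> Prop) (L : seq (bool * (vec * vec))) :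
  wpreorder lt -> (forall x, x \in L -> rel lt x.1 x.2.1 x.2.2) ->
  exists w, (forall i, 0 < w i)%N /\
    forall x, x \in L -> if x.1 then (wt w x.2.1 < wt w x.2.2)%N
                         else (wt w x.2.1 <= wt w x.2.2)%N.
Proof.
move=> wlt hL.
pose diff (p : vec * vec) : {ffun 'I_s -> int} :=
  [ffun i => (p.2 i)%:Z - (p.1 i)%:Z].
pose S b d := exists f g, rel lt b f g /\ d = diff (f, g).
(* Comparing [0] with the unit vectors forces the weights to be positive. *)
pose pos := [seq (true, (0 : vec, unitv i)) | i <- enum 'I_s].
have [| |x|w hw] := @fourier_motzkin S _ _ [seq (x.1, diff x.2) | x <- pos ++ L].
- move=> b c d d' p q p0 q0 [f [g [fg ->]]] [f' [g' [fg' ->]]].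
  exists (f *+ p + f' *+ q), (g *+ p + g' *+ q); split.
    by apply: rel_add => //; apply: rel_muln.
  have mulE (d0 : {ffun 'I_s -> int}) k i : (d0 *+ k) i = d0 i * k%:Z.
    by elim: k => [|k IHk]; rewrite ?mulr0n ?mulrS ffunE ?mulr0 // IHk -natz; ring.
  apply/ffunP => i; rewrite ffunE !mulE !ffunE /= -!/(vec) !vecMn.
  rewrite !PoszD !PoszM; ring.
- move=> [f [g [fg /ffunP e]]]; apply: (mlt_irr wlt (f := f)).
  suff {2}-> : f = g by [].
  by apply/ffunP => i; have := e i; rewrite !ffunE /=; lia.
- move=> /mapP [y + ->] /=; rewrite mem_cat => /orP [/mapP [i _ ->]|/hL hy]; last first.
    by exists y.2.1, y.2.2; split=> //; congr diff; case: (y.2).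
  exists 0, (unitv i); split=> //=; case: wlt => _ + _; apply.
  by move/ffunP/(_ i); rewrite !ffunE eqxx.
have dotE v f g : dot v (diff (f, g)) = \sum_i v i * (g i)%:R - \sum_i v i * (f i)%:R.
  rewrite -sumrB; apply: eq_bigr => i _.
  by rewrite ffunE /= -mulrBr rmorphB /= -!pmulrn.
have w0 i : 0 < w i.
  have := hw (true, diff (0, unitv i)).
  have -> : (true, diff (0, unitv i)) \in [seq (x.1, diff x.2) | x <- pos ++ L].
    apply/mapP; exists (true, (0, unitv i)) => //.
    by rewrite mem_cat; apply/orP; left; apply: map_f; rewrite mem_enum.
  move=> /(_ isT) /=; rewrite dotE (bigD1 i) //= ffunE eqxx mulr1.
  rewrite !big1 ?addr0 ?subr0 // => j; first by rewrite ffunE mulr0.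
  by rewrite ffunE => /negbTE ->; rewrite mulr0.
have [N [v [N0 vE]]] := clear_denominators w0.
exists v; split.
  by move=> i; rewrite -(ltr_nat rat) vE mulr_gt0.
have wtE f : (wt v f)%:R = N * \sum_i w i * (f i)%:R.
  rewrite /wt natr_sum big_distrr /=; apply: eq_bigr => i _.
  by rewrite natrM vE mulrA.
move=> [b [f g]] xL; have := hw (b, diff (f, g)).
have -> : (b, diff (f, g)) \in [seq (x.1, diff x.2) | x <- pos ++ L].
  by apply/mapP; exists (b, (f, g)) => //; rewrite mem_cat xL orbT.
move=> /(_ isT) /=; rewrite dotE subr_gt0 subr_ge0.
case: b {xL} => h; first by rewrite -(ltr_nat rat) !wtE ltr_pM2l.
by rewrite -(ler_nat rat) !wtE ler_pM2l.
Qed.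

(** * Dickson's lemma and its finiteness consequences *)

Lemma nondecreasing_subsequence (u : nat -> nat) : exists phi : nat -> nat,
  (forall i j, (i < j)%N -> (phi i < phi j)%N) /\
  (forall i j, (i <= j)%N -> (u (phi i) <= u (phi j))%N).
Proof.
(* Each index is taken where [u] attains its minimum on the remaining tail. *)
have hmin (n : nat) : exists k, (n <= k)%N /\ forall k', (n <= k')%N -> (u k <= u k')%N.
  pose Q v := `[< exists2 k, (n <= k)%N & u k = v >].
  have exQ : exists v, Q v by exists (u n); apply/asboolP; exists n.
  case: (ex_minnP exQ) => v /asboolP [k nk <-] vmin; exists k; split=> // k' nk'.
  by apply: vmin; apply/asboolP; exists k'.
have [f hf] := choice hmin.
pose phi := fix phi (n : nat) : nat := if n is n'.+1 then f (phi n').+1 else f 0%N.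
have S i : (phi i < phi i.+1)%N by case: (hf (phi i).+1).
have M i j : (i <= j)%N -> (phi i <= phi j)%N.
  elim: j => [|j IH]; first by rewrite leqn0 => /eqP ->.
  by rewrite leq_eqVlt => /orP [/eqP -> //|/IH h]; apply: leq_trans h (ltnW (S j)).
exists phi; split=> [i j ij|i j ij]; first exact: leq_trans (S i) (M _ _ ij).
case: i ij => [_|i ij] /=; first by case: (hf 0%N) => _; apply.
case: (hf (phi i).+1) => _; apply.
exact: leq_trans (S i) (M i.+1 j ij).
Qed.

Lemma dickson (h : nat -> vec) : exists phi : nat -> nat,
  (forall i j, (i < j)%N -> (phi i < phi j)%N) /\
  (forall i j, (i <= j)%N -> forall t, (h (phi i) t <= h (phi j) t)%N).
Proof.
suff H (n : nat) : exists phi : nat -> nat,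
  (forall i j, (i < j)%N -> (phi i < phi j)%N) /\
  (forall i j, (i <= j)%N -> forall t : 'I_s, (t < n)%N -> (h (phi i) t <= h (phi j) t)%N).
  have [phi [p1 p2]] := H s; exists phi; split=> // i j ij t; exact: p2.
elim: n => [|n [phi [p1 p2]]]; first by exists id.
case: (ltnP n s) => [lt|ge]; last first.
  exists phi; split=> // i j ij t _; apply: p2 => //; exact: leq_trans (ltn_ord t) ge.
have [psi [q1 q2]] := nondecreasing_subsequence (fun i => h (phi i) (Ordinal lt)).
have q3 i j : (i <= j)%N -> (psi i <= psi j)%N.
  by rewrite leq_eqVlt => /orP [/eqP -> //|/q1 /ltnW].
exists (phi \o psi); split=> [i j ij|i j ij t]; first by apply: p1; apply: q1.
rewrite ltnS leq_eqVlt => /orP [/eqP e|lt']; last by apply: p2 => //; apply: q3.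
by have -> : t = Ordinal lt by [apply: val_inj]; apply: q2.
Qed.

(** By Dickson's lemma an infinite descending sequence would contain a term dividing a later, hence
    smaller, one. *)
Lemma torder_ind (lt : vec -> vec -> Prop) (K : vec -> Prop) : torder lt ->
  (forall m, (forall n, lt n m -> K n) -> K m) -> forall m, K m.
Proof.
move=> [wlt _] step m; apply: contrapT => nK.
have nxt (x : {n | ~ K n}) : exists y : {n | ~ K n}, lt (sval y) (sval x).
  case: x => x nKx /=; apply: contrapT => no; apply: nKx; apply: step => y yx.
  by apply: contrapT => nKy; apply: no; exists (exist _ y nKy).
have [f hf] := choice nxt.
pose u (n : nat) := sval (iter n f (exist _ m nK)).
have uS (n : nat) : lt (u n.+1) (u n) by exact: hf.
have ult i j : (i < j)%N -> lt (u j) (u i).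
  elim: j => // j IH; rewrite ltnS leq_eqVlt => /orP [/eqP -> //|/IH].
  exact: (mlt_trans wlt (uS j)).
have [phi [p1 p2]] := dickson u.
have /vec_le [p e] := p2 0%N 1%N isT.
have := ult _ _ (p1 0%N 1%N isT); rewrite e.
case: (pselect (p = 0)) => [->|/(mlt_addr wlt (u (phi 0%N)))].
  by rewrite addr0; apply: mlt_irr.
by move=> h /(mlt_asym wlt h).
Qed.

(** Otherwise vectors could be chosen successively, none of them reducing to an earlier one; along a
    subsequence that is increasing by Dickson's lemma the ideals become stationary, a
    contradiction. *)
Lemma finitely_determined (R : comPzRingType) (C : vec -> set R) :
  noetherian R -> (forall m, ideal (C m)) -> (forall m n, C m `<=` C (m + n)) ->
  exists F : seq vec, forall h, exists2 h', h' \in F &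
    exists p, h = h' + p /\ C h `<=` C h'.
Proof.
move=> noeth hC mono; apply: contrapT => no.
have nxt (F : seq vec) : exists h, forall h', h' \in F ->
    forall p, h = h' + p -> ~ C h `<=` C h'.
  apply: contrapT => no'; apply: no; exists F => h; apply: contrapT => no2.
  apply: no'; exists h => h' h'F p hE sub; apply: no2.
  by exists h' => //; exists p.
have [g hg] := choice nxt.
pose F (n : nat) := iter n (fun F => rcons F (g F)) [::].
pose u (n : nat) := g (F n).
have uF i j : (i < j)%N -> u i \in F j.
  elim: j => // j IH; rewrite ltnS leq_eqVlt => /orP [/eqP ->|/IH h].
    by rewrite /= mem_rcons mem_head.
  by rewrite /= mem_rcons inE h orbT.
have [phi [p1 p2]] := dickson u.
have [|n|n hn] := ideal_acc noeth (I := fun n : nat => C (u (phi n))).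
- by move=> n; apply: hC.
- by have /vec_le [p ->] := p2 n n.+1 (leqnSn n); apply: mono.
have /vec_le [p e] := p2 n n.+1 (leqnSn n).
by apply: (hg (F (phi n.+1)) (u (phi n)) (uF _ _ (p1 _ _ (ltnSn n))) p e); apply: hn.
Qed.

End Exponents.

#[local] Hint Resolve sgen_sideal sgen_ideal : core.
#[local] Hint Extern 0 (ideal _) => (eapply sidealW; eassumption) : core.
#[local] Hint Extern 0 (ideal _) => (eapply prime_id; eassumption) : core.

(** * Leading coefficients and the lower bound *)

Section Monomials.
Variables (R : comPzRingType) (s : nat) (a : 'I_s -> R).
Implicit Types (g h m : vec s) (w : 'I_s -> nat) (U P J : set R).

Definition mon m : R := \prod_i a i ^+ m i.

Lemma mon0 : mon 0 = 1.
Proof. by rewrite /mon big1 // => i _; rewrite vec0. Qed.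

Lemma monD g h : mon (g + h) = mon g * mon h.
Proof. by rewrite /mon -big_split; apply: eq_bigr => i _; rewrite vecD exprD. Qed.

Lemma mon_unitv i : mon (unitv i) = a i.
Proof.
rewrite /mon (bigD1 i) //= ffunE eqxx expr1 big1 ?mulr1 // => j /negbTE ne.
by rewrite ffunE ne.
Qed.

Definition mons (K : vec s -> Prop) : set R := [set x | exists2 g, K g & x = mon g].

Lemma mons_sub (K K' : vec s -> Prop) : (forall g, K g -> K' g) -> mons K `<=` mons K'.
Proof. by move=> h x [g /h Kg ->]; exists g. Qed.

Definition wfilt U w n : set R := sgen U (mons (fun g => (n <= wt w g)%N)).

Lemma wfilt_mono U w n n' : (n <= n')%N -> wfilt U w n' `<=` wfilt U w n.
Proof. by move=> le; apply/sgen_mono/mons_sub => g; apply: leq_trans. Qed.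

Lemma wfilt_mon U w g n : (n <= wt w g)%N -> wfilt U w n (mon g).
Proof. by move=> le; apply: sub_sgen; exists g. Qed.

Lemma wfiltM U w n n' x y : wfilt U w n x -> wfilt U w n' y ->
  wfilt U w (n + n')%N (x * y).
Proof.
move=> hx hy; apply: sgen_mul hx => _ [g lg ->]; rewrite mulrC.
apply: sgen_mul hy => _ [h lh ->]; rewrite -monD; apply: wfilt_mon.
by rewrite wtD addnC leq_add.
Qed.

Lemma prod_in_mon P J n g : ideal J -> prod_in n P J -> (forall i, P (a i)) ->
  (n <= wt (fun=> 1%N) g)%N -> J (mon g).
Proof.
move=> hJ hn Pa; rewrite /mon.
pose l := flatten [seq nseq (g i) (a i) | i <- index_enum 'I_s].
have -> : \prod_i a i ^+ g i = \prod_(x <- l) x.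
  rewrite /l big_flatten big_map; apply: eq_bigr => i _.
  by elim: (g i) => [|k IH]; rewrite /= ?big_nil // big_cons exprS IH.
have -> : wt (fun=> 1%N) g = size l.
  rewrite /l size_flatten /shape -map_comp sumnE big_map /wt.
  by apply: eq_bigr => i _; rewrite /= size_nseq mul1n.
move=> le; rewrite -(cat_take_drop n l) big_cat; apply: idealMr => //.
apply: hn; first by rewrite size_takel.
move=> x /mem_take /flattenP [_ /mapP [i _ ->]].
by rewrite mem_nseq => /andP [_ /eqP ->].
Qed.

Lemma wfilt_sub U P w : (forall i, P (a i)) -> exists c, forall n J, sideal U J ->
  prod_in n P J -> wfilt U w (c * n)%N `<=` J.
Proof.
(* Every variable has weight less than this constant [c], so weight [c * n] forces degree at least
   [n]. *)
move=> Pa; exists (\sum_i w i).+1 => n J hJ hn; apply: sgen_min => // _ [g + ->] => le.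
apply: (prod_in_mon (sidealW hJ) hn Pa); rewrite -(leq_pmul2l (ltn0Sn (\sum_i w i))).
apply: leq_trans le _; rewrite /wt big_distrr /=; apply: leq_sum => i _.
rewrite mul1n leq_mul2r (bigD1 i) //=; apply/orP; right; lia.
Qed.

End Monomials.

Lemma finite_wt s (w : 'I_s -> nat) n : (forall i, 0 < w i)%N ->
  exists hs : seq (vec s), uniq hs /\ forall g, (wt w g <= n)%N -> g \in hs.
Proof.
move=> w0; exists (undup [seq [ffun i => t i : nat] | t : {ffun 'I_s -> 'I_n.+1}]).
split; first exact: undup_uniq.
move=> g le; rewrite mem_undup; apply/mapP.
exists [ffun i => inord (g i)]; first by rewrite mem_enum.
apply/ffunP => i; rewrite !ffunE inordK //.
by rewrite ltnS; apply: leq_trans (leq_wt g (w0 i)) le.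
Qed.

Lemma extremal_mem (T : eqType) (r : T -> T -> Prop) (hs : seq T) :
  (forall x y z, r x y -> r y z -> r x z) -> (forall x y, x <> y -> r x y \/ r y x) ->
  hs <> [::] -> exists2 x, x \in hs & forall y, y \in hs -> y = x \/ r x y.
Proof.
move=> rT rtot; case: hs => // x hs _; elim: hs x => [|y hs IH] x.
  by exists x; rewrite ?mem_head // => z; rewrite inE => /eqP ->; left.
have [z zh zmin] := IH y.
case: (pselect (x = z)) => [e|/rtot [xz|zx]].
- exists x; rewrite ?mem_head // => t; rewrite inE => /orP [/eqP ->|/zmin]; first by left.
  by rewrite e.
- exists x; rewrite ?mem_head // => t; rewrite inE => /orP [/eqP ->|/zmin [->|zt]]; [by left|by right|].
  by right; apply: rT zt.
exists z; first by rewrite inE zh orbT.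
by move=> t; rewrite inE => /orP [/eqP ->|/zmin //]; right.
Qed.

Section FreeFamily.
Variables (R : comPzRingType) (U : set R).

(* Members of a free family index distinct steps of a decreasing chain of
   ideals from [X] to [Y]. *)
Definition free_family (X Y : set R) (T : finType) (A : pred T)
    (L L' : T -> set R) : Prop :=
  [/\ forall t, A t -> [/\ sideal U (L t), sideal U (L' t), Y `<=` L' t,
        L' t `<=` L t & L t `<=` X],
      forall t, A t -> exists y, L t y /\ ~ L' t y &
      forall t t', A t -> A t' -> t != t' -> L t' `<=` L' t \/ L t `<=` L' t'].

End FreeFamily.

Section Coefficients.
Variables (R : comPzRingType) (U : set R) (s : nat) (a : 'I_s -> R).
Variable lt : vec s -> vec s -> Prop.
Hypothesis tlt : torder lt.
Implicit Types (g h m : vec s).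

Let wlt : wpreorder lt. Proof. by case: tlt. Qed.

(* Leading coefficients, at the monomial [m], of the relations among the [a i]. *)
Definition lead_coefs m : set R := [set r | sgen U (mons a (lt m)) (r * mon a m)].

Lemma lead_coefs_sideal m : sideal U (lead_coefs m).
Proof. exact: sideal_colon. Qed.

Lemma lead_coefsD m h : lead_coefs m `<=` lead_coefs (m + h).
Proof.
move=> r; rewrite /lead_coefs /= monD mulrA; apply: sgen_mul => _ [g mg ->].
by rewrite -monD; apply: sub_sgen; exists (g + h) => //; apply: mlt_add2r.
Qed.

Lemma sgen_finite (T : eqType) (K : T -> Prop) (F : T -> R) x :
  sgen U [set y | exists2 g : T, K g & y = F g] x -> exists gs : seq T,
    (forall g : T, g \in gs -> K g) /\ sgen U [set y | exists2 g : T, g \in gs & y = F g] x.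
Proof.
pose fin (gs : seq T) := [set y | exists2 g : T, g \in gs & y = F g].
pose J := [set x | exists gs : seq T, (forall g : T, g \in gs -> K g) /\ sgen U (fin gs) x].
apply: (sgen_min (J := J)); last first.
  move=> _ [g Kg ->]; exists [:: g]; split; first by move=> h; rewrite inE => /eqP ->.
  by apply: sub_sgen; exists g; rewrite ?mem_head.
split; first split.
- by exists [::]; split=> //; apply: ideal0.
- move=> y z [gs [Kg hy]] [gs' [Kg' hz]]; exists (gs ++ gs'); split.
    by move=> g; rewrite mem_cat => /orP [/Kg|/Kg'].
  apply: idealD => //.
    by apply: sgen_mono hy => _ [g gg ->]; exists g; rewrite // mem_cat gg.
  by apply: sgen_mono hz => _ [g gg ->]; exists g; rewrite // mem_cat gg orbT.
- by move=> r y [gs [Kg hy]]; exists gs; split=> //; apply: idealM.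
move=> u y Uu [gs [Kg hy]]; exists gs; split=> //.
by case: (sgen_sideal U (fin gs)) => _; apply; first exact: Uu.
Qed.

Hypothesis noeth : noetherian R.

(** One finite set of tails serves all [r], because the ideal of leading coefficients at [m] is
    finitely generated. *)
Lemma lead_coefs_finite m : exists gs : seq (vec s),
  (forall g, g \in gs -> lt m g) /\
  forall r, lead_coefs m r -> sgen U (mons a (fun g => g \in gs)) (r * mon a m).
Proof.
have [rs [hrs rmin]] := ideal_fg noeth (sidealW (lead_coefs_sideal m)).
suff [gs [h1 h2]] : exists gs : seq (vec s), (forall g, g \in gs -> lt m g) /\
    forall r, r \in rs -> sgen U (mons a (fun g => g \in gs)) (r * mon a m).
  exists gs; split=> //.
  by apply: (rmin _ (sidealW (sideal_colon _ (sgen_sideal _ _)))).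
elim: rs hrs {rmin} => [|r rs IH] hrs; first by exists [::].
have [|gs [h1 h2]] := IH; first by move=> x xrs; apply: hrs; rewrite inE xrs orbT.
have [gs' [h1' h2']] := sgen_finite (hrs r (mem_head _ _)).
exists (gs' ++ gs); split; first by move=> g; rewrite mem_cat => /orP [/h1'|/h1].
move=> x; rewrite inE => /orP [/eqP -> |/h2]; last first.
  by apply: sgen_mono; apply: mons_sub => g gg; rewrite mem_cat gg orbT.
by apply: sgen_mono h2'; apply: mons_sub => g gg; rewrite mem_cat gg.
Qed.

(* Approximation of [lt] by a weight: finitely many relations generate all
   leading coefficients, and [w] is chosen to be compatible with these. *)
Lemma approximating_weight : exists w, (forall i, 0 < w i)%N /\
  forall m r, lead_coefs m r ->
    sgen U (mons a (fun g => lt m g /\ (wt w m < wt w g)%N)) (r * mon a m).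
Proof.
have [F hF] := finitely_determined noeth (fun m => sidealW (lead_coefs_sideal m))
  lead_coefsD.
have [gs hgs] := choice lead_coefs_finite.
have [|w [w0 hw]] := @weights s lt [seq (true, (h, g)) | h <- F, g <- gs h] wlt.
  by move=> x /allpairsPdep [h [g [_ gh ->]]] /=; apply: (hgs h).1.
exists w; split=> // m r rm.
have [h hh [p [mE sub]]] := hF m.
have := (hgs h).2 _ (sub _ rm); rewrite mE monD mulrA; apply: sgen_mul => _ [g gg ->].
rewrite -monD; apply: sub_sgen; exists (g + p) => //.
split; first by apply: (mlt_add2r wlt); apply: (hgs h).1.
rewrite !wtD ltn_add2r; apply: (hw (true, (h, g))).
by apply/allpairsPdep; exists h, g.
Qed.

End Coefficients.

(** * The lower bound for the growth of lengths *)

Section LowerBound.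
Variables (R : comPzRingType) (P : set R) (s : nat) (a : 'I_s -> R).
Variable lt : vec s -> vec s -> Prop.
Hypotheses (noeth : noetherian R) (pP : prime_ideal P) (Pa : forall i, P (a i)).
Hypothesis tlt : torder lt.
Implicit Types (g h m : vec s).

Let wlt : wpreorder lt. Proof. by case: tlt. Qed.
Let U := avoids P.
Let mU : multset U. Proof. exact: prime_multset. Qed.

Section Weight.
Variable w : 'I_s -> nat.
Hypothesis w0 : forall i, (0 < w i)%N.
Hypothesis hw : forall m r, lead_coefs U a lt m r ->
    sgen U (mons a (fun g => lt m g /\ (wt w m < wt w g)%N)) (r * mon a m).

Definition above m n : set R := mons a (fun g => lt m g \/ (n <= wt w g)%N).

(** The monomials in [hs] are removed one by one, the [lt]-smallest [h] first. The alternative for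
    [x] puts all other terms above [h], so the coefficient at [h] is a leading coefficient, and [hw]
    trades the term for monomials of weight above [n]. *)
Lemma strip_monomials m n x (hs : seq (vec s)) : uniq hs ->
  (forall h, h \in hs -> lt h m /\ wt w h = n) ->
  (forall h r, h \in hs -> sgen U (above h n.+1) (r * mon a h) ->
     lead_coefs U a lt h r) ->
  sgen U (above m n.+1) x \/ (exists r, x = r * mon a m) ->
  sgen U (mons a (fun g => (lt m g \/ (n < wt w g)%N) \/ g \in hs)) x ->
  sgen U (above m n.+1) x.
Proof.
have [k] := ubnP (size hs); elim: k hs x => // k IH hs x; rewrite ltnS => sz un hm hlc hx hS.
case: (pselect (hs = [::])) => [e|ne].
  by apply: sgen_mono hS; apply: mons_sub => g []; rewrite // e.
have [h hhs hmin] : exists2 h, h \in hs & forall g, g \in hs -> g = h \/ lt h g.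
  by apply: (extremal_mem (mlt_trans wlt)) => // g g'; exact: (proj2 tlt).
have [ltm wth] := hm h hhs.
pose rest := mons a (fun g => (lt m g \/ (n < wt w g)%N) \/ g \in rem h hs).
have [u [c [Uu hc]]] : exists u c, [/\ U u & sgen U rest (u * x - c * mon a h)].
  apply: (sgen_add1P mU (sgen_sideal _ _)); apply: sgen_mono hS => _ [g hg ->].
  case: (eqVneq g h) => [->|gh]; first by left.
  right; apply: sub_sgen; exists g => //; case: hg => [|ghs]; [by left|right].
  by rewrite (rem_filter _ un) mem_filter ghs /= andbT.
have restP : rest `<=` above h n.+1.
  apply: mons_sub => g [[mg|]|]; [|by right|].
    by left; apply: (mlt_trans wlt) mg.
  rewrite (rem_filter _ un) mem_filter => /andP [/= gh /hmin [e|]]; last by left.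
  by rewrite e eqxx in gh.
have hch : lead_coefs U a lt h c.
  apply: hlc => //.
  have -> : c * mon a h = u * x - (u * x - c * mon a h) by ring.
  apply: idealB => //; last exact: sgen_mono hc.
  apply: idealM => //; case: hx => [|[r ->]].
    apply: sgen_mono; apply: mons_sub => g [mg|]; [left|by right].
    exact: (mlt_trans wlt) mg.
  by apply: idealM => //; apply: sub_sgen; exists m => //; left.
have : sgen U rest x.
  case: (sgen_sideal U rest) => _; apply; first exact: Uu.
  have -> : u * x = (u * x - c * mon a h) + c * mon a h by ring.
  apply: idealD => //; apply: sgen_mono (hw hch); apply: mons_sub => g [_].
  by rewrite wth => lg; left; right.
apply: (IH (rem h hs)).
- by rewrite size_rem //; case: (hs) hhs sz => //= ? ? _; lia.
- exact: rem_uniq.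
- by move=> g /mem_rem /hm.
- by move=> g r /mem_rem; apply: hlc.
- exact: hx.
Qed.

(* The weight order has no other leading coefficients than [lt]: a relation at
   [m] for the weight whose [lt]-smaller terms cannot be removed gives a relation
   at such a smaller term; if they can be removed forever, Krull's intersection
   theorem applies. *)
Lemma lead_coefs_above m r : sgen U (above m (wt w m).+1) (r * mon a m) ->
  lead_coefs U a lt m r.
Proof.
move: m r; apply: (torder_ind tlt) => m IH r hr.
(* The weight of the terms that are not [lt]-larger than [m] is pushed up beyond every bound. *)
have H k : sgen U (above m (wt w m + k).+1) (r * mon a m).
  elim: k => [|k IHk]; first by rewrite addn0.
  rewrite addnS; set n := (wt w m + k).+1 in IHk *.
  have [hs0 [un hs0P]] := finite_wt n w0.
  pose hs := [seq h <- hs0 | `[< lt h m >] && (wt w h == n)].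
  have hsP h : h \in hs -> lt h m /\ wt w h = n.
    by rewrite mem_filter => /andP [/andP [/asboolP ? /eqP ?] _].
  apply: (@strip_monomials _ _ _ hs) => //; first exact: filter_uniq.
  - move=> h c /hsP [hm hn] hc; apply: IH => //; by rewrite hn.
  - by right; exists r.
  apply: sgen_mono IHk; apply: mons_sub => g [|]; first by left; left.
  rewrite leq_eqVlt => /orP [/eqP ng|]; last by left; right.
  case: (pselect (g = m)) => [e|/(proj2 tlt) [gm|]]; last by left; left.
    by exfalso; move: ng; rewrite e /n; lia.
  right; rewrite mem_filter hs0P; last by rewrite -ng.
  by rewrite -ng eqxx !andbT; apply/asboolP.
apply: (krull_intersection noeth pP (sgen_sideal _ _)) => n J hJ sub hn.
have [c hc] := wfilt_sub U w Pa.
have {}hc := hc n J hJ hn.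
apply: sgen_min (H (c * n)%N) => // _ [g [mg|lg] ->].
  by apply: sub; apply: sub_sgen; exists g.
by apply: hc; apply: wfilt_mon; lia.
Qed.

End Weight.

Lemma lower_bound m0 e : (forall m, ~ lead_coefs U a lt m 1) ->
  prod_in e P (lead_coefs U a lt m0) ->
  exists c, forall k, (0 < k)%N -> exists D (L L' : {ffun 'I_s -> 'I_k} -> set R),
    [/\ sideal U D, prod_in (c * k)%N P D & free_family U setT D predT L L'].
Proof.
move=> n1 he; have [w [w0 hw]] := approximating_weight U a tlt noeth.
(* [n] exceeds the weight of every monomial whose exponents are all below [k]. *)
pose W := (\sum_i w i).+1; exists (e * W)%N => k k0; pose n := (k * W)%N.
(* Each block of [e] elements of [P], multiplied by [mon a m0], gains at least one unit over the
   weight of [m0]. *)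
have hprod n' (l : seq R) : size l = (e * n')%N -> (forall x, x \in l -> P x) ->
    wfilt a U w (n' * (wt w m0).+1)%N (\prod_(x <- l) x * mon a (m0 *+ n')).
  elim: n' l => [|n' IH] l sl Pl.
    by rewrite mul0n mulr0n mon0 mulr1 -[\prod_(_ <- _) _]mulr1 -(mon0 a);
      apply: idealM; [exact: sgen_ideal | exact: wfilt_mon].
  rewrite -(cat_take_drop e l) big_cat /= mulrS monD mulrACA mulSn; apply: wfiltM.
    have /hw : lead_coefs U a lt m0 (\prod_(x <- take e l) x).
      apply: he; first by rewrite size_takel // sl mulnS leq_addr.
      by move=> x /mem_take; apply: Pl.
    by apply: sgen_mono; apply: mons_sub => g [].
  apply: IH; first by rewrite size_drop sl mulnS addKn.
  by move=> x /mem_drop; apply: Pl.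
pose D := [set r | wfilt a U w (n * (wt w m0).+1)%N (r * mon a (m0 *+ n))].
have hD : sideal U D by apply: sideal_colon; apply: sgen_sideal.
pose v (t : {ffun 'I_s -> 'I_k}) : vec s := [ffun i => t i : nat].
have wv t : (wt w (v t) < n)%N.
  apply: (@leq_ltn_trans (k.-1 * \sum_i w i)%N).
    rewrite /wt big_distrr /=; apply: leq_sum => i _; rewrite ffunE mulnC leq_mul2r.
    by apply/orP; right; have := ltn_ord (t i); lia.
  by rewrite /n /W; nia.
have vI : injective v.
  move=> t t' /ffunP h; apply/ffunP => i; apply: val_inj.
  by have := h i; rewrite !ffunE.
exists D, (fun t => sgen U (mons a (fun g => g = v t \/ lt (v t) g) `|` D)),
  (fun t => sgen U (mons a (lt (v t)) `|` D)); split=> //.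
  by move=> l sl Pl; apply: hprod => //; rewrite sl /n; ring.
split.
- move=> t _; split=> //; first by move=> x Dx; apply: sub_sgen; right.
  apply: sgen_mono => x [[g lg ->]|Dx]; last by right.
  by left; exists g => //; right.
- move=> t _; exists (mon a (v t)); split.
    by apply: sub_sgen; left; exists (v t) => //; left.
  (* If the step at [v t] were trivial, multiplication by [mon a (m0 *+ n)] would give a relation
     with leading coefficient [1] at [v t + m0 *+ n], since the terms coming from [D] have larger
     weight than this vector. *)
  move=> ht; apply: (n1 (v t + m0 *+ n)).
  apply: (lead_coefs_above w0 hw); rewrite mul1r monD.
  apply: sgen_mul ht => y [[g lg ->]|Dy].
    rewrite -monD; apply: sub_sgen; exists (g + m0 *+ n) => //; left.
    exact: mlt_add2r.
  apply: sgen_mono Dy; apply: mons_sub => g lg; right.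
  by apply: leq_trans lg; rewrite wtD wtMn; have := wv t; nia.
move=> t t' _ _ /eqP tt'.
have [tv|tv] := proj2 tlt (v t) (v t') (fun e => tt' (vI _ _ e)); [left|right].
  apply: sgen_mono => x [[g lg ->]|Dx]; last by right.
  left; exists g => //; case: lg => [-> //|lg]; exact: (mlt_trans wlt) lg.
apply: sgen_mono => x [[g lg ->]|Dx]; last by right.
left; exists g => //; case: lg => [-> //|lg]; exact: (mlt_trans wlt) lg.
Qed.

End LowerBound.

(** * Lengths and the upper bound *)

Section Length.
Variables (R : comPzRingType) (P : set R).
Hypotheses (noeth : noetherian R) (pP : prime_ideal P).
Implicit Types (X Y Z : set R).

Let U := avoids P.
Let mU : multset U. Proof. exact: prime_multset. Qed.

(** The length of [X / Y] over the localization at [P] is at most [M], length being measured by free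
    families. *)
Variant len_le X Y (M : nat) : Prop :=
  LenLe of forall (T : finType) (A : pred T) (L L' : T -> set R),
    free_family U X Y A L L' -> (#|A| <= M)%N.

Lemma len_leS X Y X' Y' M M' : X' `<=` X -> Y `<=` Y' -> (M <= M')%N ->
  len_le X Y M -> len_le X' Y' M'.
Proof.
move=> sX sY sM [h]; split=> T A L L' [h1 h2 h3]; apply: leq_trans sM; apply: (h T A L L').
split=> [t /h1 [? ? YL ? LX]|//|]; last exact: h3.
by split=> //; [apply: subset_trans YL|apply: subset_trans sX].
Qed.

Lemma len_le0 X : len_le X X 0.
Proof.
split=> T A L L' [h1 h2 _]; rewrite leqn0; apply/eqP/eq_card0 => t.
apply/negP => At; have [y [Ly nLy]] := h2 t At; have [_ _ YL _ LX] := h1 t At.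
by apply: nLy; apply: YL; apply: LX.
Qed.

(** Locally, [X / Y] is simple or zero: an element of the lower of two steps that lies outside [Y]
    generates all of [X] modulo [Y], which collapses the upper step. *)
Lemma len_le1 X Y :
  (forall y y', X y -> X y' -> ~ Y y' -> exists u r, U u /\ Y (u * y - r * y')) ->
  len_le X Y 1.
Proof.
move=> simple; split=> T A L L' [h1 h2 h3]; rewrite leqNgt; apply/negP => /card_gt1P.
case=> t [t' [At At' ne]].
wlog tt' : t t' At At' ne / L t' `<=` L' t => [W|].
  by case: (h3 t t' At At' ne) => h; [apply: (W t t')|apply: (W t' t); rewrite // eq_sym].
have [y [Ly nLy]] := h2 t At; have [y' [Ly' nLy']] := h2 t' At'.
have [sL sL' YL' L'L LX] := h1 t At; have [_ _ YLt' _ LX'] := h1 t' At'.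
have [u [r [Uu hY]]] := simple y y' (LX _ Ly) (LX' _ Ly') (fun h => nLy' (YLt' _ h)).
apply: nLy; case: (sL') => _; apply; first exact: Uu.
rewrite -[u * y](subrK (r * y')); apply: idealD => //; first exact: YL'.
by apply: idealM => //; apply: tt'.
Qed.

(** A step whose new elements all lie outside [Y] survives modulo [Y]; any other step survives
    intersection with [Y]. *)
Lemma len_le_trans X Y Z M N : sideal U X -> sideal U Y -> Z `<=` Y -> Y `<=` X ->
  len_le X Y M -> len_le Y Z N -> len_le X Z (M + N).
Proof.
move=> sX sY ZY YX [hM] [hN]; split=> T A L L' [h1 h2 h3].
pose B t := `[< L t `&` Y `<=` L' t >].
rewrite -(cardID B A); apply: leq_add.
  apply: (hM _ _ (fun t => sgen U (Y `|` L t)) (fun t => sgen U (Y `|` L' t))); split.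
  - move=> t /andP [At Bt]; have [sL sL' YL' L'L LX] := h1 t At; split=> //.
    + by move=> y Yy; apply: sub_sgen; left.
    + by apply: sgen_mono => y [|/L'L]; [left|right].
    + by apply: sgen_min => // y [/YX|/LX].
  - move=> t /andP [At /asboolP Bt]; have [sL sL' YL' L'L LX] := h1 t At.
    have [y [Ly nLy]] := h2 t At; exists y; split; first by apply: sub_sgen; right.
    case/(sgen_addP mU (sidealW sL')) => u [z [z' [Uu hz L'z' e]]].
    apply: nLy; case: (sL') => _; apply; first exact: Uu.
    rewrite e; apply: idealD => //; apply: Bt; split; last first.
      by apply: sgen_min hz => //; apply: sideal_ideal.
    rewrite -[z](addrK z') -e; apply: idealB => //; last exact: L'L.
    exact: idealM.
  move=> t t' /andP [At _] /andP [At' _] /(h3 _ _ At At') [h|h]; [left|right];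
    by apply: sgen_mono => y [|/h]; [left|right].
apply: (hN _ _ (fun t => L t `&` Y) (fun t => L' t `&` Y)); split.
- move=> t /andP [Bt At]; have [sL sL' YL' L'L LX] := h1 t At.
  split; try exact: sidealI.
  + by move=> y Zy; split; [apply: YL'|apply: ZY].
  + by move=> y [/L'L].
  + by move=> y [].
- move=> t /andP [/asboolP nB At]; apply: contrapT => no; apply: nB => y [Ly Yy].
  by apply: contrapT => nLy; apply: no; exists y; split=> // -[].
move=> t t' /andP [_ At] /andP [_ At'] /(h3 _ _ At At') [h|h]; [left|right];
  by move=> y [/h].
Qed.

Lemma len_le_span (zs : seq R) Y M : sideal U Y ->
  (forall z Y', z \in zs -> sideal U Y' -> Y `<=` Y' ->
     len_le (sgen U ([set z] `|` Y')) Y' M) ->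
  len_le (sgen U ([set z | z \in zs] `|` Y)) Y (size zs * M).
Proof.
elim: zs Y => [|z zs IH] Y sY h.
  by apply: (len_leS _ _ _ (len_le0 Y)) => //; apply: sgen_min => // y [].
pose Y1 := sgen U ([set z] `|` Y).
have YY1 : Y `<=` Y1 by move=> y Yy; apply: sub_sgen; right.
have sY1 : sideal U Y1 by apply: sgen_sideal.
rewrite [size _]/= mulSn addnC.
apply: (@len_leS (sgen U ([set z | z \in zs] `|` Y1)) Y _ _ (size zs * M + M)) => //.
  apply: sgenS => y [|Yy]; last by apply: sub_sgen; right; apply: YY1.
  rewrite /= inE => /orP [/eqP ->|yz]; last by apply: sub_sgen; left.
  by apply: sub_sgen; right; apply: sub_sgen; left.
apply: (@len_le_trans _ Y1) => //.
- by move=> y Yy; apply: sub_sgen; right.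
- apply: IH => // t Y' tz sY' sub; apply: h => //; first by rewrite inE tz orbT.
  exact: subset_trans sub.
by apply: h; rewrite ?mem_head.
Qed.

(** Induction on [e]: the ideal of [z] modulo [P z] is simple or zero, and [P z] is generated by
    finitely many [p * z], each killed by products with one factor fewer. The bound is uniform in
    [z] and [Y]. *)
Lemma len_le_nilpotent e : exists r, forall z Y, sideal U Y ->
  (forall l : seq R, size l = e -> (forall x, x \in l -> P x) -> Y (\prod_(x <- l) x * z)) ->
  len_le (sgen U ([set z] `|` Y)) Y r.
Proof.
have [ps [hps pmin]] := ideal_fg noeth (prime_id pP).
elim: e => [|e [r IH]].
  exists 0%N => z Y sY hz; apply: (len_leS _ _ _ (len_le0 Y)) => //.
  apply: sgen_min => // y [->|//].
  by have := hz [::] erefl; rewrite big_nil mul1r; apply.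
exists (1 + size ps * r)%N => z Y sY hz.
pose Y1 := sgen U ([set x | exists2 p, P p & x = p * z] `|` Y).
have YY1 : Y `<=` Y1 by move=> y Yy; apply: sub_sgen; right.
have sY1 : sideal U Y1 by apply: sgen_sideal.
apply: (@len_le_trans _ Y1) => //.
- apply: sgenS => y [[p Pp ->]|Yy]; last by apply: sub_sgen; right.
  by apply: idealM => //; apply: sub_sgen; left.
- apply: len_le1 => y y' /(sgen_add1P mU sY) [u [t [Uu hu]]].
  move=> /(sgen_add1P mU sY) [v [t' [Uv hv]]] nY'.
  have Ut' : U t'.
    move=> Pt'; apply: nY'; case: (sgen_sideal U ([set x | exists2 p, P p & x = p * z] `|` Y)).
    move=> _; apply; first exact: Uv.
    rewrite -[v * y'](subrK (t' * z)); apply: idealD => //; first exact: YY1.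
    by apply: sub_sgen; left; exists t'.
  exists (t' * u), (t * v); split; first by case: mU => _; apply.
  have -> : t' * u * y - t * v * y' = t' * (u * y - t * z) - t * (v * y' - t' * z) by ring.
  by apply: idealB => //; apply: idealM => //; apply: YY1.
pose zs := [seq p * z | p <- ps].
apply: (@len_leS (sgen U ([set y | y \in zs] `|` Y)) Y _ _ (size zs * r)) => //.
- apply: sgenS => y [[p Pp ->]|Yy]; last by apply: sub_sgen; right.
  have hc := sideal_colon z (sgen_sideal U ([set y | y \in zs] `|` Y)).
  apply: (pmin _ (sidealW hc)) Pp => q qps.
  by apply: sub_sgen; left; apply: map_f.
- by rewrite /zs size_map.
apply: len_le_span => // x Y' /mapP [p pps ->] sY' sub; apply: IH => // l sl Pl.
apply: sub; rewrite mulrA [_ * p]mulrC; have := hz (p :: l); rewrite big_cons.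
apply; first by rewrite /= sl.
by move=> q; rewrite inE => /orP [/eqP ->|/Pl //]; apply: hps.
Qed.

End Length.

Lemma card_ord_lt (N m : nat) : (#|[pred x : 'I_N | x < m]| <= m)%N.
Proof.
rewrite cardE -(size_map val) -[leqRHS](size_iota 0); apply: uniq_leq_size.
  by rewrite map_inj_uniq ?enum_uniq //; apply: val_inj.
by move=> x /mapP [y + ->]; rewrite mem_enum mem_iota.
Qed.

Lemma card_coord_lt (s N m : nat) (i : 'I_s) :
  (#|[pred t : {ffun 'I_s -> 'I_N} | t i < m]| <= m * N ^ s.-1)%N.
Proof.
pose F (j : 'I_s) : pred 'I_N := if j == i then [pred x : 'I_N | (x < m)%N] else predT.
have -> : #|[pred t : {ffun 'I_s -> 'I_N} | (t i < m)%N]| = #|family F|.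
  apply: eq_card => t; rewrite inE; apply/idP/familyP => [lt j|/(_ i)].
    by rewrite /F; case: eqP => [->|_]; rewrite inE.
  by rewrite /F eqxx inE.
rewrite card_family foldrE big_map big_enum /= (bigD1 i) //=.
apply: leq_mul; first by rewrite /F eqxx; apply: card_ord_lt.
rewrite (eq_bigr (fun=> N)) => [|j /negbTE ne]; last first.
  by rewrite /F ne; apply: etrans (card_ord N); apply: eq_card.
rewrite prod_nat_const; have := cardC1 i; rewrite card_ord => <-.
by rewrite leq_eqVlt; apply/orP; left; apply/eqP; congr expn; apply: eq_card.
Qed.

(** Non-divisibility by [m] confines some coordinate to a fixed finite range, which costs one
    dimension; hence the exponent [s.-1] in the upper bound. *)
Lemma card_nondivisible (s N : nat) (m : vec s) :
  (#|[pred t : {ffun 'I_s -> 'I_N} | [exists i, t i < m i]]| <= (\sum_i m i) * N ^ s.-1)%N.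
Proof.
have -> : #|[pred t : {ffun 'I_s -> 'I_N} | [exists i, t i < m i]%N]| =
    #|[pred t : {ffun 'I_s -> 'I_N} | has (fun i => t i < m i)%N (enum 'I_s)]|.
  apply: eq_card => t; rewrite !inE; apply/existsP/hasP => -[i].
    by exists i; rewrite ?mem_enum.
  by move=> _; exists i.
rewrite -big_enum /=; elim: (enum 'I_s) => [|i l IH].
  by rewrite big_nil eq_card0 // => t; rewrite inE.
rewrite big_cons mulnDl; apply: leq_trans (leq_add (card_coord_lt N (m i) i) IH).
rewrite -cardUI; apply: leq_trans (leq_addr _ _).
by apply: subset_leq_card; apply/fintype.subsetP => t; rewrite !inE.
Qed.

(** * The upper bound for the growth of lengths *)

Section UpperBound.
Variables (R : comPzRingType) (P : set R) (s : nat) (a : 'I_s -> R).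
Variables (lt : vec s -> vec s -> Prop) (w : 'I_s -> nat) (m : vec s) (e : nat).
Hypotheses (noeth : noetherian R) (pP : prime_ideal P) (Pa : forall i, P (a i)).
Hypotheses (tlt : torder lt) (w0 : forall i, (0 < w i)%N).
Hypothesis he : prod_in e P (sgen (avoids P) [set x | exists i, x = a i]).
Implicit Types (g h : vec s).

Let wlt : wpreorder lt. Proof. by case: tlt. Qed.
Let U := avoids P.
Let mU : multset U. Proof. exact: prime_multset. Qed.

(* Besides larger monomials, any monomial of weight at least [wt w m] with a
   coefficient in [P] is allowed: for a preorder, the initial form may contain
   terms equivalent to the one with an invertible coefficient. *)
Definition relation_terms : set R :=
  mons a (fun g => (wt w m < wt w g)%N \/ (wt w g = wt w m /\ lt m g)) `|`
  [set x | exists p g, [/\ P p, (wt w m <= wt w g)%N & x = p * mon a g]].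

Hypothesis hrel : sgen U relation_terms (mon a m).

Definition standard n g : Prop := wt w g = n /\ exists i, (g i < m i)%N.

(** Standard monomials of weight [n], products of [P^j] with monomials of weight at least [n], and
    higher weight; raising [j] to [e] absorbs the middle summand. *)
Let Y n j : set R := sgen U (mons a (standard n) `|`
  ([set x | exists (l : seq R) g, [/\ size l = j, forall x, x \in l -> P x,
      (n <= wt w g)%N & x = \prod_(x <- l) x * mon a g]] `|`
   wfilt a U w n.+1)).

(** An [lt]-largest counterexample [g] has weight [n] and is divisible by [m]; [hrel] rewrites it by
    terms of higher weight, larger monomials of weight [n], and terms with a coefficient in [P]. *)
Lemma wfilt_standard1 n h : (n <= wt w h)%N -> Y n 1 (mon a h).
Proof.
move=> le; apply: contrapT => nY.
have wfY x : wfilt a U w n.+1 x -> Y n 1 x by move=> hx; apply: sub_sgen; right; right.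
have bad g : ~ Y n 1 (mon a g) -> (n <= wt w g)%N -> wt w g = n.
  move=> nYg; rewrite leq_eqVlt => /orP [/eqP //|lg]; exfalso; apply: nYg.
  by apply: wfY; apply: wfilt_mon.
have [hs0 [_ hs0P]] := finite_wt n w0.
pose hs := [seq g <- hs0 | `[< ~ Y n 1 (mon a g) >] && (n <= wt w g)%N].
have hsP g : g \in hs <-> ~ Y n 1 (mon a g) /\ (n <= wt w g)%N.
  split; first by rewrite mem_filter => /andP [/andP [/asboolP ? ?] _].
  move=> [nYg lg]; rewrite mem_filter hs0P ?(bad _ nYg lg) // leqnn !andbT.
  exact/asboolP.
have gtT x y z : lt y x -> lt z y -> lt z x by move=> yx zy; apply: (mlt_trans wlt) zy yx.
have gtN x y : x <> y -> lt y x \/ lt x y by move/(proj2 tlt) => []; [right|left].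
have [|g /hsP [nYg lg] gmax] := extremal_mem gtT gtN (hs := hs).
  by have := (hsP h).2 (conj nY le) => + e0; rewrite e0.
have wg := bad _ nYg lg; apply: nYg.
case: (pselect (exists i, (g i < m i)%N)) => [st|nst].
  by apply: sub_sgen; left; exists g.
have [p gE] : exists p, g = m + p.
  by apply: vec_le => i; rewrite leqNgt; apply/negP => lti; apply: nst; exists i.
rewrite gE monD; apply: sgen_mul hrel => x [[g' hg' ->]|[q [g' [Pq lg' ->]]]].
  rewrite -monD; have [lt1|[wg' ltg']] := hg'.
    by apply: wfY; apply: wfilt_mon; rewrite -wg gE !wtD ltn_add2r.
  apply: contrapT => nYg'.
  have /gmax : g' + p \in hs.
    by apply/hsP; split=> //; rewrite wtD wg' -wtD -gE wg.
  have lt2 : lt g (g' + p) by rewrite gE; apply: mlt_add2r.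
  case=> [e0|/(mlt_asym wlt) //]; by move: lt2; rewrite e0; apply: mlt_irr.
rewrite -mulrA -monD; apply: sub_sgen; right; left; exists [:: q], (g' + p).
split=> //; first by move=> y; rewrite inE => /eqP ->.
  by rewrite -wg gE !wtD leq_add2r.
by rewrite big_seq1.
Qed.

(** Iteration produces [e] coefficients in [P], whose product lies locally in the ideal of the [a i]
    by [he]; this raises the weight. *)
Lemma wfilt_standard n :
  wfilt a U w n `<=` sgen U (mons a (standard n) `|` wfilt a U w n.+1).
Proof.
have H j : wfilt a U w n `<=` Y n j.
  elim: j => [|j IH].
    apply: (sgen_min (sgen_sideal _ _)) => _ [g lg ->]; apply: sub_sgen; right; left.
    by exists [::], g; rewrite big_nil mul1r.
  apply: (subset_trans IH); apply: sgenS => x [sx|[[l [g [sl Pl lg ->]]]|wx]].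
  - by apply: sub_sgen; left.
  - rewrite mulrC; apply: sgen_mul (wfilt_standard1 lg) => y [[h sh ->]|[[l' [h [sl' Pl' lh ->]]]|wy]].
    + by rewrite mulrC; apply: idealM; [exact: sgen_ideal|apply: sub_sgen; left; exists h].
    + apply: sub_sgen; right; left; exists (l' ++ l), h; split=> //.
      * by rewrite size_cat sl sl' add1n.
      * by move=> z; rewrite mem_cat => /orP [/Pl'|/Pl].
      * by rewrite big_cat /=; ring.
    + by rewrite mulrC; apply: idealM; [exact: sgen_ideal|apply: sub_sgen; right; right].
  - by apply: sub_sgen; right; right.
apply: (subset_trans (H e)); apply: sgenS => x [sx|[[l [g [sl Pl lg ->]]]|wx]].
- by apply: sub_sgen; left.
- apply: sub_sgen; right; apply: (@wfilt_mono _ _ _ _ _ _ (1 + wt w g)%N).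
    by rewrite add1n ltnS.
  apply: wfiltM; last exact: wfilt_mon.
  apply: (sgen_min (sgen_sideal _ _) _ (he sl Pl)) => _ [i ->]; rewrite -mon_unitv; apply: wfilt_mon.
  by rewrite wt_unitv.
- by apply: sub_sgen; right.
Qed.

Let v N (t : {ffun 'I_s -> 'I_N}) : vec s := [ffun i => t i : nat].

(** The layer of weight [n] is generated by its standard monomials, each killed by [P^e]. Monomials
    of weight below [N] have exponents below [N], so they are indexed by ['I_N]. *)
Lemma len_le_wfilt : exists r, forall N n, (n <= N)%N ->
  len_le P setT (wfilt a U w n)
    ((\sum_(j < n) #|[pred t : {ffun 'I_s -> 'I_N} | `[< standard j (v t) >]]|) * r)%N.
Proof.
have [r hr] := len_le_nilpotent noeth pP e; exists r => N; elim=> [|n IH] ltN.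
  rewrite big_ord0 mul0n; apply: (len_leS _ _ _ (len_le0 P setT)) => // x _.
  rewrite -[x]mulr1; apply: idealM; first exact: sgen_ideal.
  by rewrite -(mon0 a); apply: wfilt_mon.
rewrite big_ord_recr /= mulnDl.
apply: (len_le_trans pP _ _ _ _ (IH (ltnW ltN))) => //.
- exact: sgen_sideal.
- exact: wfilt_mono.
pose zs := [seq mon a (v t) | t <- enum [pred t : {ffun 'I_s -> 'I_N} | `[< standard n (v t) >]]].
have sY : sideal U (wfilt a U w n.+1) by exact: sgen_sideal.
apply: (@len_leS _ P (sgen U ([set z | z \in zs] `|` wfilt a U w n.+1)) (wfilt a U w n.+1) _ _ (size zs * r)) => //.
- apply: (subset_trans (@wfilt_standard n)); apply: sgen_mono => x [[g [wg [i gi]] ->]|]; last by right.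
  left; apply/mapP.
  have hg j : (g j < N)%N.
    by apply: leq_ltn_trans ltN; rewrite -wg; apply: leq_wt.
  have vg : v [ffun j => Ordinal (hg j)] = g by apply/ffunP => j; rewrite !ffunE.
  exists [ffun j => Ordinal (hg j)]; last by rewrite vg.
  by rewrite mem_enum; apply/asboolP; rewrite vg; split=> //; exists i.
- by rewrite /zs size_map -cardE.
apply: (len_le_span pP sY) => z Y' /mapP [t + ->] sY' sub.
rewrite mem_enum => /asboolP [wt_t _]; apply: hr => // l sl Pl; apply: sub.
apply: (@wfilt_mono _ _ _ _ _ _ (1 + wt w (v t))%N); first by rewrite add1n wt_t.
apply: wfiltM; last exact: wfilt_mon.
apply: (sgen_min (sgen_sideal _ _) _ (he sl Pl)) => _ [i ->]; rewrite -mon_unitv; apply: wfilt_mon.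
by rewrite wt_unitv.
Qed.

Lemma upper_bound : exists c, forall k D, sideal U D -> prod_in k P D ->
  forall (T : finType) (A : pred T) (L L' : T -> set R),
    free_family U setT D A L L' -> (#|A| <= c * k ^ s.-1)%N.
Proof.
have [r hr] := len_le_wfilt; have [c hc] := wfilt_sub U w Pa.
exists ((\sum_i m i) * c ^ s.-1 * r)%N => k D sD kD T A L L' free.
have [/(_ _ _ _ _ free) le] := len_leS (@subset_refl _ _) (hc k D sD kD) (leqnn _) (hr _ _ (leqnn (c * k)%N)).
apply: (leq_trans le).
rewrite [leqRHS](_ : _ = (\sum_i m i) * (c * k) ^ s.-1 * r)%N; last by rewrite expnMn; ring.
rewrite leq_mul2r; apply/orP; right.
apply: leq_trans (card_nondivisible _ m).
set N := (c * k)%N.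
pose B := [pred t : {ffun 'I_s -> 'I_N} | [exists i, t i < m i]%N].
have cardE (C : pred {ffun 'I_s -> 'I_N}) : #|[pred t | C t]| = (\sum_t C t)%N.
  by rewrite -sum1_card big_mkcond; apply: eq_bigr => t _; rewrite inE; case: (C t).
rewrite -/B (cardE B) (eq_bigr _ (fun j _ => cardE _)) exchange_big /=.
(* Every [t] is counted at most once, namely at [j] equal to its weight. *)
apply: leq_sum => t _; case: (boolP [exists i, t i < m i]%N) => [_|nB] /=.
  case: (leqP N (wt w (v t))) => [ge|ltN].
    rewrite big1 // => j _; case: asboolP => // -[e0 _].
    by have := ltn_ord j; rewrite -e0 ltnNge ge.
  rewrite (bigD1 (Ordinal ltN)) //= big1 ?addn0; first exact: leq_b1.
  move=> j; rewrite -val_eqE /= => ne; case: asboolP => // -[e0 _].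
  by rewrite e0 eqxx in ne.
rewrite big1 // => j _; case: asboolP => // -[_ [i lti]].
by case/negP: nB; apply/existsP; exists i; rewrite /v ffunE in lti.
Qed.

End UpperBound.

(** * Monomial preorders and polynomials *)

Section Orders.
Variable s : nat.
Implicit Types (f g h m : vec s).

Lemma torder_intro (lt : vec s -> vec s -> Prop) :
  (forall f, ~ lt f f) -> (forall f g h, lt f g -> lt g h -> lt f h) ->
  (forall f g, f <> g -> lt f g \/ lt g f) -> (forall f, f <> 0 -> lt 0 f) ->
  (forall f g h, lt f g -> lt (f + h) (g + h)) -> torder lt.
Proof.
move=> irr tr tot pos add; split=> //; split=> //.
  move=> f g h fg; split; last by move=> gf; apply: (irr f); apply: tr gf.
  case: (pselect (f = h)) => [<-|/tot [fh|hf]]; [by right|by left|].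
  by right; apply: tr fg.
move=> f g h; split=> [/add //|fg].
case: (pselect (f = g)) => [e|/tot [//|/(add _ _ h) gf]].
  by case: (irr (f + h)); rewrite {2}e.
by case: (irr (f + h)); apply: tr gf.
Qed.

Definition lex f g : Prop :=
  exists i : 'I_s, (f i < g i)%N /\ forall j : 'I_s, (j < i)%N -> f j = g j.

Lemma lex_torder : torder lex.
Proof.
have tot f g : f <> g -> lex f g \/ lex g f.
  move=> fg; pose Q k := [exists i : 'I_s, (i == k :> nat) && (f i != g i)].
  have exQ : exists k, Q k.
    apply: contrapT => no; apply: fg; apply/ffunP => i; apply/eqP; rewrite -[_ == _]negbK.
    by apply/negP => ne; apply: no; exists i; apply/existsP; exists i; rewrite eqxx.
  case: (ex_minnP exQ) => k /existsP [i /andP [/eqP ik fgi]] kmin.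
  have eqj (j : 'I_s) : (j < i)%N -> f j = g j.
    move=> ji; apply/eqP; rewrite -[_ == _]negbK; apply/negP => ne.
    have /kmin : Q j by apply/existsP; exists j; rewrite eqxx.
    by rewrite -ik leqNgt ji.
  have [lt|lt|e] := ltngtP (f i) (g i); last by rewrite e eqxx in fgi.
    by left; exists i.
  by right; exists i; split=> // j /eqj.
apply: torder_intro => //.
- by move=> f [i []]; rewrite ltnn.
- move=> f g h [i [fgi fg]] [j [ghj gh]].
  have [ij|ji|/val_inj e] := ltngtP i j.
  + exists i; rewrite -(gh i ij); split=> // k ki.
    by rewrite fg // gh //; apply: ltn_trans ij.
  + exists j; rewrite (fg j ji); split=> // k kj.
    by rewrite fg ?gh //; apply: ltn_trans ji.
  exists i; split=> [|k ki]; first by rewrite e in fgi *; apply: ltn_trans ghj.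
  by rewrite fg // gh // -e.
- move=> f f0; case: (tot 0 f) => [e|//|[i []]]; first by apply: f0.
  by rewrite vec0 ltn0.
move=> f g h [i [fgi fg]]; exists i; rewrite !vecD ltn_add2r; split=> // j /fg e.
by rewrite !vecD e.
Qed.

(** Ties are broken lexicographically to get a total order whose least monomial in a support is
    still minimal for [lt]. *)
Definition refine_lex (lt : vec s -> vec s -> Prop) f g : Prop :=
  lt f g \/ (~ lt g f /\ lex f g).

Lemma refine_lex_torder lt : wpreorder lt -> torder (refine_lex lt).
Proof.
move=> wlt; have [wlex tlex] := lex_torder.
have rlt b f g h : rel lt b f g -> forall c, rel lt c g h -> rel lt (b || c) f h.
  by move=> h1 c; apply: rel_trans.
apply: torder_intro.
- by move=> f [/mlt_irr|[_ /mlt_irr]]; apply.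
- move=> f g h [fg|[fg lfg]] [gh|[gh lgh]].
  + by left; apply: (rlt true _ g _ fg true).
  + by left; apply: (rlt true _ g _ fg false).
  + by left; apply: (rlt false _ g _ fg true).
  + right; split; first by apply: (rlt false _ g _ fg false).
    exact: mlt_trans lgh.
- move=> f g fg; case: (pselect (lt f g)) => [|nfg]; first by left; left.
  case: (pselect (lt g f)) => [|ngf]; first by right; left.
  by case: (tlex f g fg) => h; [left|right]; right.
- by move=> f f0; left; case: wlt => _ + _; apply.
move=> f g h [fg|[fg lfg]]; first by left; apply: mlt_add2r.
by right; split; [apply: (rel_add2r wlt h (b := false))|apply: mlt_add2r].
Qed.

Definition to_monom f : monom :=
  mkcmonom [fsfun i in [fset i | i in iota 0 s]%fset => oapp f 0%N (insub i) | 0%N].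

Lemma to_monomE f i : to_monom f i = oapp f 0%N (insub i).
Proof.
rewrite /to_monom cmE fsfun_fun; case: ifP => // /negbT.
by rewrite in_fset /= mem_iota /= => lt; rewrite insubN.
Qed.

Lemma to_monom_ord f (i : 'I_s) : to_monom f i = f i.
Proof. by rewrite to_monomE valK. Qed.

Lemma to_monom_out f i : (s <= i)%N -> to_monom f i = 0%N.
Proof. by move=> le; rewrite to_monomE insubN // -leqNgt. Qed.

Lemma to_monomD f g : to_monom (f + g) = mmul (to_monom f) (to_monom g).
Proof.
apply/eqP/cmP => i; rewrite cmM; case: (ltnP i s) => [lt|le]; last by rewrite !to_monom_out.
by have := to_monom_ord _ (Ordinal lt) => /= e; rewrite !e vecD.
Qed.

Lemma to_monom_inj : injective to_monom.
Proof.
by move=> f g e; apply/ffunP => i; rewrite -!to_monom_ord e.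
Qed.

Lemma to_monom0 : to_monom 0 = mone.
Proof.
apply/eqP/cmP => i; rewrite cm1; case: (ltnP i s) => [lt|le]; last by rewrite to_monom_out.
by rewrite (to_monom_ord _ (Ordinal lt)) vec0.
Qed.

Definition of_monom (m : monom) : vec s := [ffun i : 'I_s => m i].

Lemma of_monomK (m : monom) : (forall i, (s <= i)%N -> m i = 0%N) ->
  to_monom (of_monom m) = m.
Proof.
move=> h; apply/eqP/cmP => i; case: (ltnP i s) => [lt|le].
  by rewrite (to_monom_ord _ (Ordinal lt)) ffunE.
by rewrite to_monom_out // h.
Qed.

Lemma monomial_wpreorder (lt : monom -> monom -> Prop) : monomial_preorder lt ->
  wpreorder (fun f g => lt (to_monom f) (to_monom g)).
Proof.
move=> [swo pos add]; split.
- move=> f g h; exact: swo.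
- move=> f f0; rewrite to_monom0; apply: pos => e; apply: f0; apply: to_monom_inj.
  by rewrite e to_monom0.
by move=> f g h; rewrite !to_monomD; apply: add.
Qed.

End Orders.

(** * Dependence expressed by relations among monomials *)

Section Polynomials.
Variables (R : comPzRingType) (s : nat) (a : s.-tuple R).
Implicit Types (p q : {malg R[monom]}) (g h m : vec s).

Definition power_product (n : monom) : R := \prod_(i < s) tnth a i ^+ n i.

Lemma power_product_monom m : power_product (to_monom m) = mon (tnth a) m.
Proof. by apply: eq_bigr => i _; rewrite to_monom_ord. Qed.

Lemma poly_evalE p (D : {fset monom}) : (msupp p `<=` D)%fset ->
  poly_eval a p = \sum_(n <- D) p@_n * power_product n.
Proof.
move=> sub; rewrite /poly_eval; apply: (big_fset_incl _ sub) => n _ /mcoeff_outdom ->.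
by rewrite mul0r.
Qed.

Lemma poly_evalD p q : poly_eval a (p + q) = poly_eval a p + poly_eval a q.
Proof.
pose D := (msupp p `|` msupp q)%fset.
rewrite (@poly_evalE p D) ?fsubsetUl // (@poly_evalE q D) ?fsubsetUr //.
rewrite (@poly_evalE _ D) ?msuppD_le // -big_split.
by apply: eq_bigr => n _; rewrite mcoeffD mulrDl.
Qed.

Lemma poly_evalN p : poly_eval a (- p) = - poly_eval a p.
Proof.
rewrite (@poly_evalE _ (msupp p)) ?msuppN // -sumrN.
by apply: eq_bigr => n _; rewrite mcoeffN mulNr.
Qed.

Lemma poly_evalU r n : poly_eval a << r *g n >> = r * power_product n.
Proof.
by rewrite (@poly_evalE _ [fset n]%fset) ?msuppU_le // big_seq_fset1 mcoeffUU.
Qed.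

Definition pscale r p : {malg R[monom]} := [malg n in msupp p => r * p@_n].

Lemma pscaleE r p n : (pscale r p)@_n = r * p@_n.
Proof.
by rewrite mcoeffE; case: ifP => // /negbT /mcoeff_outdom ->; rewrite mulr0.
Qed.

Lemma msupp_pscale r p : (msupp (pscale r p) `<=` msupp p)%fset.
Proof.
apply/fsubsetP => n; rewrite -!mcoeff_neq0 pscaleE; apply: contraNneq => ->.
by rewrite mulr0.
Qed.

Lemma poly_eval_pscale r p : poly_eval a (pscale r p) = r * poly_eval a p.
Proof.
rewrite (poly_evalE (msupp_pscale r p)) /poly_eval big_distrr /=.
by apply: eq_bigr => n _; rewrite pscaleE mulrA.
Qed.

Lemma initial_formE (lt : monom -> monom -> Prop) p n :
  (initial_form lt p)@_n =
  if `[< forall m' : monom, m' \in msupp p -> ~ lt m' n >] then p@_n else 0.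
Proof.
rewrite /initial_form raddf_sum /=.
rewrite (eq_bigr (fun k => p@_k *+ (k == n))) => [|k _]; last exact: mcoeffU.
rewrite big_mkcond /=; case: (boolP (n \in msupp p)) => [np|nnp].
  rewrite (bigD1_seq n) ?fset_uniq //= eqxx mulr1n big1 ?addr0 // => k /negbTE ->.
  by rewrite mulr0n if_same.
rewrite (mcoeff_outdom nnp) if_same big1_seq // => k /= kp.
case: (eqVneq k n) => [e|_]; last by rewrite mulr0n if_same.
by rewrite -e kp in nnp.
Qed.

(** Such a relation is the vanishing of [x^m - p] with all monomials of [p] larger than [m] for the
    refined order, so [m] survives in the initial form with coefficient [1]. *)
Lemma dependent_of_lead_coefs (lt : monom -> monom -> Prop) m :
  monomial_preorder lt ->
  lead_coefs [set 1] (tnth a)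
    (refine_lex (fun f g => lt (to_monom f) (to_monom g))) m 1 ->
  dependent lt a.
Proof.
move=> /(monomial_wpreorder s) wlt; set rlt := refine_lex _.
have [wr _] : torder rlt by exact: refine_lex_torder.
pose good p := forall n, n \in msupp p -> exists2 g, n = to_monom g & rlt m g.
pose J := [set x | exists2 p, good p & poly_eval a p = x].
have hJ : ideal J.
  split.
  - by exists 0; rewrite /good /poly_eval ?msupp0 ?big_seq_fset0.
  - move=> _ _ [p hp <-] [q hq <-]; exists (p + q); last exact: poly_evalD.
    by move=> n /(fsubsetP (msuppD_le p q)); rewrite in_fsetU => /orP [/hp|/hq].
  - move=> r _ [p hp <-]; exists (pscale r p); last exact: poly_eval_pscale.
    by move=> n /(fsubsetP (msupp_pscale r p)) /hp.
rewrite /lead_coefs /= mul1r => /(sgen_min (sideal_ideal hJ)) [].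
  move=> _ [g mg ->]; exists << 1 *g to_monom g >>.
    by move=> n /(fsubsetP msuppU_le); rewrite in_fset1 => /eqP ->; exists g.
  by rewrite poly_evalU mul1r power_product_monom.
move=> p hp pE; pose f := << 1 *g to_monom m >> - p.
have nmp : to_monom m \notin msupp p.
  apply/negP => /hp [g /to_monom_inj <-]; exact: mlt_irr.
have fsub n : n \in msupp f -> n = to_monom m \/ n \in msupp p.
  move/(fsubsetP (msuppB_le _ _)); rewrite in_fsetU => /orP [|]; last by right.
  by move/(fsubsetP msuppU_le); rewrite in_fset1 => /eqP; left.
exists f; split.
- move=> n /fsub [->|/hp [g -> _]] i; exact: to_monom_out.
- by rewrite /f poly_evalD poly_evalN poly_evalU mul1r power_product_monom pE subrr.
exists (to_monom m), 1; rewrite mulr1 initial_formE asboolT.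
  by rewrite /f mcoeffB mcoeffUU (mcoeff_outdom nmp) subr0.
move=> n /fsub [->|/hp [g -> [mg|[gm _]]]]; last exact: gm.
  exact: (mlt_irr wlt).
exact: (mlt_asym wlt).
Qed.

(** [m] is lexicographically least among the [lt]-minimal monomials with coefficient outside [P],
    and [w] respects the comparisons of [m] with the support; division by the coefficient, a local
    unit, gives the relation. *)
Lemma relation_of_dependent (lt : monom -> monom -> Prop) P :
  monomial_preorder lt -> prime_ideal P -> dependent lt a ->
  exists w m, (forall i, 0 < w i)%N /\
    sgen (avoids P) (relation_terms P (tnth a) (@lex s) w m) (mon (tnth a) m).
Proof.
move=> /(monomial_wpreorder s); set lt' := fun f g => _ => wlt pP.
move=> [f [f_vars f_eval [n1 [u]]]]; rewrite initial_formE.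
case: asboolP => [n1min fu|_ e]; last first.
  by case: pP => [[P0 _ _]] []; rewrite -e mul0r.
have [wlex tlex] := lex_torder s.
have suppE n : n \in msupp f -> n = to_monom (of_monom s n).
  by move=> nf; rewrite of_monomK // => i; apply: f_vars.
pose V := [seq of_monom s n | n <- msupp f].
have VP g : g \in V -> to_monom g \in msupp f.
  by move=> /mapP [n nf ->]; rewrite -suppE.
pose c g := f@_(to_monom g).
pose cand := [seq g <- V | `[< ~ P (c g) /\ forall h, h \in V -> ~ lt' h g >]].
have [|m] := extremal_mem (mlt_trans wlex) tlex (hs := cand).
  have n1f : n1 \in msupp f.
    rewrite -mcoeff_neq0; apply/eqP => e; rewrite e mul0r in fu.
    by case: pP => [[P0 _ _]] []; rewrite -fu.
  suff : of_monom s n1 \in cand by move=> + e; rewrite e.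
  rewrite mem_filter map_f // andbT; apply/asboolP; rewrite /c -suppE //; split.
    by move=> Pf; case: (pP) => _ []; rewrite -fu; apply: idealMr.
  by move=> h /VP /n1min; rewrite /lt' -suppE.
rewrite mem_filter => /andP [/asboolP [nPm mmin] mV] mlex.
have [|w [w0 hw]] := @weights s lt' [seq (`[< lt' m g >], (m, g)) | g <- V] wlt.
  by move=> x /mapP [g gV ->] /=; case: asboolP => //= _; apply: mmin.
exists w, m; split=> //.
case: (sgen_sideal (avoids P) (relation_terms P (tnth a) (@lex s) w m)) => _ sat.
apply: (sat (c m)); first exact: nPm.
move: f_eval; rewrite /poly_eval (bigD1_seq (to_monom m)) ?fset_uniq ?VP //=.
rewrite -/(power_product _) power_product_monom -/(c m) => /eqP; rewrite addr_eq0 => /eqP ->.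
apply: idealN => //; rewrite big_seq_cond; apply: ideal_sum => // n /andP [nf nm].
rewrite -/(power_product _) (suppE n nf) power_product_monom; set g := of_monom s n.
have gV : g \in V by apply: map_f.
have gm : g <> m by move=> e; case/eqP: nm; rewrite (suppE n nf) -/g e.
have := hw (`[< lt' m g >], (m, g)) (map_f _ gV) => /= wg.
have le : (wt w m <= wt w g)%N by move: wg; case: asboolP => _ // /ltnW.
case: (pselect (P (c g))) => [Pc|nPc].
  by apply: sub_sgen; right; exists (c g), g.
apply: idealM => //; apply: sub_sgen; left; exists g => //.
move: wg; case: asboolP => [_ lg|nmg _]; first by left.
move: le; rewrite leq_eqVlt => /orP [/eqP e|]; last by left.
right; split=> //.
(* Not being [lt]-larger than [m], the monomial [g] is [lt]-minimal too, so the lexicographic choice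
   of [m] applies. *)
have /mlex [//|//] : g \in cand.
rewrite mem_filter gV andbT; apply/asboolP; split=> // h hV.
exact: (rel_trans wlt (b := false) (c := false) nmg (mmin h hV)).
Qed.

End Polynomials.

(** * Independent sequences and dimension *)

Section InitialIdeal.
Variables (R : comPzRingType) (s : nat) (a : 'I_s -> R).
Variable lt : vec s -> vec s -> Prop.
Hypothesis tlt : torder lt.

Definition initial_ideal : set R := [set r | exists m, lead_coefs [set 1] a lt m r].

Lemma initial_ideal_ideal : ideal initial_ideal.
Proof.
have hC m := sidealW (lead_coefs_sideal [set 1] a lt m).
split.
- by exists 0; apply: ideal0.
- move=> x y [m hx] [n hy]; exists (m + n); apply: idealD => //.
    exact: lead_coefsD.
  by rewrite addrC; apply: lead_coefsD.
- by move=> r x [m hx]; exists m; apply: idealM.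
Qed.

Lemma initial_ideal_gen i : initial_ideal (a i).
Proof.
exists 0; rewrite /lead_coefs /= mon0 mulr1 -mon_unitv; apply: sub_sgen.
exists (unitv i) => //; case: tlt => -[_ pos _] _; apply: pos.
by move/ffunP/(_ i); rewrite !ffunE eqxx.
Qed.

(** The ideal is a directed union over the monomials and is finitely generated. *)
Lemma initial_ideal_attained : noetherian R -> exists m, initial_ideal `<=` lead_coefs [set 1] a lt m.
Proof.
move=> noeth; have [g [hg gmin]] := ideal_fg noeth initial_ideal_ideal.
have hC m := sidealW (lead_coefs_sideal [set 1] a lt m).
suff [m hm] : exists m, forall x, x \in g -> lead_coefs [set 1] a lt m x.
  by exists m; apply: gmin.
elim: g hg {gmin} => [|x g IH] hg; first by exists 0.
have [|m hm] := IH; first by move=> y yg; apply: hg; rewrite inE yg orbT.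
have [n hn] := hg x (mem_head _ _).
exists (m + n) => y; rewrite inE => /orP [/eqP ->|/hm hy]; last exact: lead_coefsD.
by rewrite addrC; apply: lead_coefsD.
Qed.

(** Inclusion in [P] keeps [1] from becoming a leading coefficient after localization; minimality
    supplies the power of [P] for [lower_bound]. *)
Lemma initial_ideal_growth P : noetherian R -> prime_ideal P ->
  initial_ideal `<=` P -> minimal_over initial_ideal P ->
  exists c, forall k, (0 < k)%N -> exists D (L L' : {ffun 'I_s -> 'I_k} -> set R),
    [/\ sideal (avoids P) D, prod_in (c * k)%N P D &
        free_family (avoids P) setT D predT L L'].
Proof.
move=> noeth pP sub minP; have [m hm] := initial_ideal_attained noeth.
have [e [u nPu he]] := minimal_nilpotent noeth initial_ideal_ideal pP minP.
apply: (lower_bound noeth pP _ tlt (m0 := m) (e := e)).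
- by move=> i; apply: sub; apply: initial_ideal_gen.
- move=> m' /(sgen1P (prime_multset pP)) [v nPv hv]; apply: nPv; apply: sub.
  by exists m'; rewrite /lead_coefs /= -[v]mulr1 -mulrA.
move=> l sl Pl; have := hm _ (he l sl Pl) => /sgen1_sub hl.
case: (sgen_sideal (avoids P) (mons a (lt m))) => _; apply; first exact: nPu.
by rewrite mulrA.
Qed.

End InitialIdeal.

Lemma growth_contradiction (R : comPzRingType) (P : set R) (s s' c c' : nat) :
  (0 < s)%N -> (s <= s')%N ->
  (forall k, (0 < k)%N -> exists D (L L' : {ffun 'I_s' -> 'I_k} -> set R),
    [/\ sideal (avoids P) D, prod_in (c * k)%N P D &
        free_family (avoids P) setT D predT L L']) ->
  (forall k D, sideal (avoids P) D -> prod_in k P D ->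
   forall (T : finType) (A : pred T) (L L' : T -> set R),
    free_family (avoids P) setT D A L L' -> (#|A| <= c' * k ^ s.-1)%N) -> False.
Proof.
(* Chosen so that [k ^ s] exceeds [c' * (c * k) ^ s.-1]. *)
move=> s0 ss' lower upper; pose k := (c' * c ^ s.-1).+1.
have [D [L [L' [sD hD free]]]] := lower k (ltn0Sn _).
have := upper _ D sD hD _ _ _ _ free.
rewrite card_ffun !card_ord leqNgt => /negP; apply.
apply: (@leq_trans (k ^ s)); last by rewrite leq_pexp2l.
rewrite expnMn mulnA -[in ltnRHS](prednK s0) expnS ltn_mul2r expn_gt0 /=.
exact: ltnSn.
Qed.

(** * Sequences from chains of primes, for the lexicographic order *)

Section LexSequences.
Variable R : comPzRingType.

Local Notation lex_ideal c := (initial_ideal c (@lex _)).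

Section Extension.
Variables (n : nat) (c : 'I_n -> R) (b : R).

Definition extend (i : 'I_n.+1) : R := oapp c b (insub (val i)).

Let front (m : vec n.+1) : vec n := [ffun i => m (widen_ord (leqnSn n) i)].
Let ext (g : vec n) (k : nat) : vec n.+1 := [ffun i => oapp g k (insub (val i))].

Let extW (g : vec n) k i : ext g k (widen_ord (leqnSn n) i) = g i.
Proof. by rewrite ffunE /= valK. Qed.

Let ext_max (g : vec n) k : ext g k ord_max = k.
Proof. by rewrite ffunE /= insubN // ltnn. Qed.

Let mon_extend m : mon extend m = mon c (front m) * b ^+ m ord_max.
Proof.
rewrite /mon big_ord_recr /= /extend /= insubN ?ltnn //=; congr (_ * _).
by apply: eq_bigr => i _; rewrite ffunE valK.
Qed.

Let front_ext g k : front (ext g k) = g.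
Proof. by apply/ffunP => i; rewrite ffunE extW. Qed.

Lemma lex_extend m g : lex m g -> lex (front m) (front g) \/
  front m = front g /\ (m ord_max < g ord_max)%N.
Proof.
move=> [i [lt eqj]]; case: (ltnP i n) => [lti|ge].
  left; exists (Ordinal lti); split.
    by rewrite !ffunE; have -> : widen_ord (leqnSn n) (Ordinal lti) = i by apply: val_inj.
  by move=> j ji; rewrite !ffunE; apply: eqj.
have ei : i = ord_max by apply: val_inj => /=; have := ltn_ord i; lia.
right; split; last by rewrite -ei.
by apply/ffunP => j; rewrite !ffunE; apply: eqj; rewrite /= ei /=.
Qed.

(** If [r] is a leading coefficient at a monomial of degree [j] in the last variable, then
    [(r - t * b) * b ^+ j] is one for [c] for some [t], hence in [Q]; as [b] is in [P] but not in
    [Q], [r] is in [P]. *)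
Lemma lex_ideal_extend_sub Q P : prime_ideal Q -> prime_ideal P -> Q `<=` P ->
  lex_ideal c `<=` Q -> P b -> ~ Q b -> lex_ideal extend `<=` P.
Proof.
move=> pQ pP QP cQ Pb nQb r [m]; rewrite /lead_coefs /= mon_extend.
set m' := front m; set j := m ord_max => hr.
have : sgen [set 1] ([set mon c m' * b ^+ j.+1] `|` sgen [set 1] (mons c (lex m')))
    (r * (mon c m' * b ^+ j)).
  apply: sgenS hr => _ [g /lex_extend [lg|[eg lg]] ->]; rewrite mon_extend.
    apply: sub_sgen; right; apply: idealMr => //; apply: sub_sgen.
    by exists (front g).
  rewrite -eg -(subnKC lg) exprD mulrA; apply: idealMr => //.
  by apply: sub_sgen; left.
case/(sgen_add1P (multset1 R) (sgen_sideal _ _)) => _ [t [-> ht]].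
have /cQ : lex_ideal c ((r - t * b) * b ^+ j).
  exists m'; rewrite /lead_coefs /=; have <- // : 1 * (r * (mon c m' * b ^+ j)) -
    t * (mon c m' * b ^+ j.+1) = (r - t * b) * b ^+ j * mon c m' by rewrite exprS; ring.
case: (pQ) => _ _ PM /PM [/QP Prt|/(prime_exp pQ) //].
rewrite -[r](subrK (t * b)); apply: idealD => //; exact: idealM.
Qed.

Lemma lex_ideal_extend : lex_ideal c `<=` lex_ideal extend.
Proof.
move=> r [m hr]; exists (ext m 0%N); rewrite /lead_coefs /= mon_extend front_ext.
rewrite ext_max expr0 mulr1; apply: sgen_mono hr => _ [g [i [lt eqj]] ->].
exists (ext g 0%N); last by rewrite mon_extend front_ext ext_max expr0 mulr1.
exists (widen_ord (leqnSn n) i); rewrite !extW; split=> // j ji.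
have ltj : (j < n)%N by apply: ltn_trans (ltn_ord i).
have -> : j = widen_ord (leqnSn n) (Ordinal ltj) by apply: val_inj.
by rewrite !extW; apply: eqj.
Qed.

Lemma lex_ideal_extend_last : lex_ideal extend b.
Proof.
have := initial_ideal_gen extend (lex_torder n.+1) ord_max.
by rewrite /extend /= insubN // ltnn.
Qed.

End Extension.

Lemma lex_sequence (n : nat) (p : nat -> set R) : prime_chain n p ->
  exists c : 'I_n -> R, lex_ideal c `<=` p n.
Proof.
elim: n => [|n IH] [hp inc].
  exists (fun=> 0) => r [m]; rewrite /lead_coefs /= /mon big_ord0 mulr1.
  have p0 := prime_id (hp 0%N isT).
  by apply: (sgen_min (sideal_ideal p0)) => x [g [i]]; have := ltn_ord i.
have [|c hc] := IH.
  by split=> i lt; [apply: hp; apply: ltnW|apply: inc; apply: ltnW].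
have [sub nsub] := inc n (ltnSn n).
have [b Pb nQb] : exists2 b, p n.+1 b & ~ p n b.
  by apply: contrapT => no; apply: nsub => x px; apply: contrapT => nx; apply: no; exists x.
exists (extend c b).
exact: (lex_ideal_extend_sub (hp _ (leqnSn n)) (hp _ (leqnn _)) sub hc Pb nQb).
Qed.

(** A maximal lex ideal inside [Q] of a sequence of length at least [n] works: if a prime above it
    were strictly below [Q], appending an element of [Q] outside that prime would enlarge the
    ideal. *)
Lemma maximal_lex_sequence (n : nat) Q : noetherian R -> height_ge Q n ->
  exists n' (c : 'I_n' -> R), [/\ (n <= n')%N, lex_ideal c `<=` Q & minimal_over (lex_ideal c) Q].
Proof.
move=> noeth [p hp pn]; have pQ : prime_ideal Q by rewrite -pn; case: hp => + _; apply.
have [c0 hc0] := lex_sequence hp; rewrite pn in hc0.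
pose K C := exists n' (c : 'I_n' -> R), [/\ (n <= n')%N, C = lex_ideal c & C `<=` Q].
have [|C [_ [n' [c [le -> CQ]]] _ Cmax]] := @max_ideal _ noeth K _ (initial_ideal_ideal c0 (lex_torder n)).
  by exists n, c0.
exists n', c; split=> // Q1 pQ1 CQ1 Q1Q; apply: contrapT => nsub.
have [b Qb nQ1b] : exists2 b, Q b & ~ Q1 b.
  by apply: contrapT => no; apply: nsub => x px; apply: contrapT => nx; apply: no; exists x.
have sub := lex_ideal_extend_sub pQ1 pQ Q1Q CQ1 Qb nQ1b.
apply: nQ1b; apply: CQ1.
apply: (Cmax _ (initial_ideal_ideal _ (lex_torder n'.+1)) _ (@lex_ideal_extend n' c b)).
  by exists n'.+1, (extend c b); split=> //; apply: leqW.
exact: lex_ideal_extend_last.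
Qed.

End LexSequences.

(** * Krull dimension and chains of primes *)

Section KrullDimension.
Variable R : comPzRingType.

Lemma prime_chain_le n n' (p : nat -> set R) : (n <= n')%N -> prime_chain n' p -> prime_chain n p.
Proof.
move=> le [hp inc]; split=> i lt; [apply: hp|apply: inc]; exact: leq_trans le.
Qed.

Lemma krull_dim_geP n : ((n%:Z)%:E <= krull_dim R)%E <-> exists p : nat -> set R, prime_chain n p.
Proof.
pose N := [set n | exists p : nat -> set R, prime_chain n p].
rewrite /krull_dim -/N; set A := [set _ | _ in N].
split=> [le|[p hp]].
  apply: contrapT => no.
  have ubA : ubound A ((n%:Z - 1)%:E).
    move=> _ [k [p hp] <-]; rewrite lee_fin; case: (ltnP k n) => [|ge]; first lia.
    by case: no; exists p; apply: prime_chain_le ge hp.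
  have : (supremum -oo%E A <= (n%:Z - 1)%:E)%E.
    rewrite /supremum; case: ifP => _; first exact: leNye.
    case: xgetP => [y _ [_ ylb]|_]; [exact: ylb|exact: leNye].
  by move=> /(le_trans le); rewrite lee_fin; lia.
apply: ge_supremum_Nmem; last by exists n => //; exists p.
(* A least upper bound has to be exhibited: the maximal length if lengths are bounded, and [+oo]
   otherwise. *)
case: (pselect (exists M, forall k, N k -> (k <= M)%N)) => [[M hM]|unb].
  have exN : exists k, `[< N k >] by exists n; apply/asboolP; exists p.
  case: (@ex_maxnP (fun k => `[< N k >]) M exN) => [k /asboolP /hM //|k /asboolP Nk kmax].
  exists k%:Z%:E; split; last by move=> y; apply; exists k.
  by move=> _ [j Nj <-]; rewrite lee_fin lez_nat; apply: kmax; apply/asboolP.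
exists +oo%E; split; first by move=> y _; apply: leey.
move=> [r|_|yub]; [move=> yub; exfalso|exact: leey|exfalso].
  apply: unb; exists `|r|%N => k Nk; have : (k%:Z%:E <= r%:E)%E by apply: yub; exists k.
  by rewrite lee_fin; lia.
by have : (n%:Z%:E <= -oo :> \bar int)%E by apply: yub; exists n => //; exists p.
Qed.

End KrullDimension.

Lemma minimal_generators (R : comPzRingType) s (a : 'I_s -> R) (P : set R) :
  noetherian R -> prime_ideal P ->
  minimal_over (sgen [set 1] [set x | exists i, x = a i]) P ->
  exists e, prod_in e P (sgen (avoids P) [set x | exists i, x = a i]).
Proof.
move=> noeth pP minP.
have [e [u nPu he]] := minimal_nilpotent noeth (sgen_ideal _ _) pP minP.
exists e => l sl Pl; have /sgen1_sub hl := he l sl Pl.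
by case: (sgen_sideal (avoids P) [set x | exists i, x = a i]) => _; apply; first exact: nPu.
Qed.

Theorem theorem3p5 (R : comPzRingType) (s : nat) (R_noeth : noetherian R)
    (s_gt0 : (0 < s)%N) :
  ((s%:Z%:E <= krull_dim R)%E ->
     exists a : s.-tuple R,
       forall lt : monom -> monom -> Prop,
         monomial_preorder lt -> independent lt a) /\
  ((krull_dim R < s%:Z%:E)%E ->
     forall (a : s.-tuple R) (lt : monom -> monom -> Prop),
       monomial_preorder lt -> dependent lt a).
Proof.
split=> [/krull_dim_geP [p hp]|dimR a lt lt_mp].
  have pP : prime_ideal (p s) by case: hp => + _; apply.
  have hP : height_ge (p s) s by exists p.
  have [b [Pb hb]] := height_sequence R_noeth s pP.
  pose a := [tuple b i | i < s].
  have aE i : tnth a i = b i by rewrite tnth_mktuple.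
  pose I := sgen [set 1] [set x | exists i, x = tnth a i].
  have IP : I `<=` p s.
    apply: sgen_min; first by apply: sideal_ideal; apply: prime_id.
    by move=> _ [i ->]; rewrite aE; apply: Pb.
  have [Q [pQ IQ QP minQ]] := minimal_prime R_noeth (sgen_ideal _ _) pP IP.
  have Qa i : Q (tnth a i) by apply: IQ; apply: sub_sgen; exists i.
  (* [Q] lies in [p s], so it either equals [p s] or has height at least [s] by the choice of
     [b]. *)
  have hQ : height_ge Q s.
    have [|PQ|//] := hb Q pQ; last by have -> : Q = p s by apply/seteqP.
    by move=> i lt; have := Qa (Ordinal lt); rewrite aE.
  have [n [c [le cQ minc]]] := maximal_lex_sequence R_noeth hQ.
  have [k1 lower] := initial_ideal_growth (lex_torder n) R_noeth pQ cQ minc.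
  have [e he] := minimal_generators R_noeth pQ minQ.
  exists a => lt lt_mp dep.
  have [w [m [w0 hrel]]] := relation_of_dependent lt_mp pQ dep.
  have [k2 upper] := upper_bound R_noeth pQ Qa (lex_torder s) w0 he hrel.
  exact: growth_contradiction s_gt0 le lower upper.
apply: contrapT => indep.
pose lt' := refine_lex (fun f g : vec s => lt (to_monom f) (to_monom g)).
have tlt : torder lt' by apply: refine_lex_torder; apply: monomial_wpreorder.
pose C := initial_ideal (tnth a) lt'.
have nC1 : ~ C 1 by move=> [m /(dependent_of_lead_coefs lt_mp)].
have [P0 pP0 CP0] := exists_prime R_noeth (initial_ideal_ideal _ tlt) nC1.
have [P [pP CP _ minP]] := minimal_prime R_noeth (initial_ideal_ideal _ tlt) pP0 CP0.
have [k1 lower] := initial_ideal_growth tlt R_noeth pP CP minP.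
have [b [Pb hb]] := height_sequence R_noeth s.-1 pP.
(* Padding by [0] lets the upper bound for [s] elements apply; the last entry then satisfies the
   required relation trivially, since its monomial vanishes. *)
pose a' (i : 'I_s) := if (i < s.-1)%N then b i else 0.
have Pa' i : P (a' i).
  by rewrite /a'; case: ifP => // _; apply: ideal0; apply: prime_id.
have [|e he] := @minimal_generators R s a' P R_noeth pP.
  (* A prime over the generators strictly below [P] has height at least [s - 1], which would give
     [P] height at least [s], more than the dimension allows. *)
  move=> Q pQ IQ QP; apply: contrapT => nPQ.
  have [|//|hQ] := hb Q pQ.
    move=> i lti; have lts : (i < s)%N by lia.
    have : Q (a' (Ordinal lts)) by apply: IQ; apply: sub_sgen; exists (Ordinal lts).
    by rewrite /a' /= lti.
  have [|q hq _] := height_ge_succ hQ pP; first by split.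
  rewrite prednK // in hq.
  by have /krull_dim_geP : exists q : nat -> set R, prime_chain s q by [exists q]; rewrite leNgt dimR.
have lts : (s.-1 < s)%N by rewrite prednK.
have mon0' : mon a' (unitv (Ordinal lts)) = 0.
  by rewrite mon_unitv /a' /= ltnn.
have [|k2 upper] := upper_bound R_noeth pP Pa' (lex_torder s) (w := fun=> 1%N)
  (m := unitv (Ordinal lts)) (fun=> isT) he.
  by rewrite mon0'; apply: ideal0; apply: sgen_ideal.
exact: growth_contradiction s_gt0 (leqnn s) lower upper.
Qed.
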